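(* Let $\Lambda$ be a ribbon graph order with base field $k$ and complete gentle quiver $(Q,I)$, let $m:G_0\to\mathbb{N}^+$ be a map on the set $G_0$ of its $\sigma$-orbits and let $\varepsilon$ be any polarization of $\Lambda$. Let $A=\Lambda/z\Lambda$ with $z=\sum_{a\in Q_1}c_a^{m(v_a)}$ be the corresponding twisted Brauer graph algebra. Then the following statements hold: (1) The map $\overline{\varepsilon}:A\to A$, $\overline{x}\mapsto\overline{\varepsilon^\star(x)}$ is a well-defined $k$-algebra involution. Moreover, there is an isomorphism $A^*\cong A_{\overline{\varepsilon}}$ of $A$-bimodules. (2) If the ribbon graph order $\Lambda$ is symmetric or if the $k$-algebra $A$ is isomorphic to some Brauer graph algebra, then the $k$-algebra $A$ is symmetric.
   Context: $k$ is a field, $R=k[[t]]$. All modules are finitely generated left modules. Paths are composed from right to left; products of non-composable arrows are zero; $s(a)$ is the start vertex of an arrow $a$. A finite quiver with relations $(Q,I)$ is complete gentle if (1) there are exactly two arrows starting and exactly two arrows ending at each vertex; (2) for any arrow $b\in Q_1$ there are unique arrows $a,c\in Q_1$ such that $cb\notin I$ and $ba\notin I$; (3) the ideal $I$ is generated by paths of length two. For $a\in Q_1$ let $\sigma(a)$ be the unique arrow with $\sigma(a)a\notin I$; this defines a permutation $\sigma$ of $Q_1$. Let $v_a$ be the $\sigma$-orbit of $a$, $n(a)$ its length and $c_a=\sigma^{n(a)-1}(a)\cdots\sigma(a)a$. Orders are assumed basic, so the ribbon graph order $\Lambda$ of $(Q,I)$ over $k$ is the arrow ideal completion of $kQ/I$;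 $e_i$ is the idempotent of the vertex $i$. $\Lambda$ is viewed as an $R$-order (an $R$-algebra free of finite rank over $R$) via $t\mapsto z$. A polarization of $\Lambda$ is a map $\varepsilon:Q_1\to\{+,-\}$, $a\mapsto\varepsilon_a$, such that $\varepsilon_a\ne\varepsilon_b$ for any two different arrows $a,b$ with the same start vertex; $\varepsilon_a x$ means $\pm x$ according to the sign. The involution of $\varepsilon$ is the unique $R$-algebra morphism $\varepsilon^\star:\Lambda\to\Lambda$ with $\varepsilon^\star(e_i)=e_i$ for $i\in Q_0$ and $\varepsilon^\star(a)=\varepsilon_{\sigma(a)}\varepsilon_a a$ for $a\in Q_1$. $A^*=\mathrm{Hom}_k(A,k)$; $A_{\overline{\varepsilon}}$ is the $A$-bimodule $A$ with regular left structure and right structure $a\star b=a\,\overline{\varepsilon}(b)$. The $R$-order $\Lambda$ is symmetric if $\Lambda\cong\mathrm{Hom}_R(\Lambda,R)$ as $\Lambda$-bimodules; a finite-dimensional $k$-algebra $A$ is symmetric if $A\cong A^*$ as $A$-bimodules. A Brauer graph algebra is a finite-dimensional $k$-algebra Morita equivalent to $kQ'/(I'+J_-)$ for some complete gentle quiver $(Q',I')$ and some map $m'$ from its $\sigma$-orbits to $\mathbb{N}^+$, where $J_-$ is the ideal generated by $c_a^{m'(v_a)}-c_b^{m'(v_b)}$ for all arrows $a,b$ with $s(a)=s(b)$. *)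

(* Defs.v *)
From HB Require Import structures.
From mathcomp Require Import all_boot all_order all_algebra generic_quotient.
From mathcomp Require Import boolp classical_sets functions cardinality.

Set Implicit Arguments.
Unset Strict Implicit.
Unset Printing Implicit Defensive.

Import GRing.Theory.
Local Open Scope classical_set_scope.
Local Open Scope ring_scope.
Local Open Scope quotient_scope.

(* An algebra over R is a ring A with a ring morphism R -> A of central image;
   [scal c] is c times the unit.  The library's [algType] requires 1 != 0, which
   a quotient by an arbitrary ideal need not satisfy. *)
HB.mixin Record PzRing_isAlgebraOver (R : comPzRingType) A
    of GRing.PzRing A := {
  scal : R -> A;
  scal_zmod : zmod_morphism scal;
  scal_monoid : monoid_morphism scal;
  scal_central : forall (c : R) (x : A), scal c * x = x * scal c
}.
#[short(type="algebraOver")]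
HB.structure Definition AlgebraOver (R : comPzRingType) :=
  {A of GRing.PzRing A & PzRing_isAlgebraOver R A}.

HB.instance Definition _ (R : comPzRingType) (A : algebraOver R) :=
  GRing.isZmodMorphism.Build R A scal (@scal_zmod R A).
HB.instance Definition _ (R : comPzRingType) (A : algebraOver R) :=
  GRing.isMonoidMorphism.Build R A scal (@scal_monoid R A).

Section Ideals.
Variable A : pzRingType.

Definition is_ideal (I : set A) : Prop :=
  [/\ I 0, forall x y, I x -> I y -> I (x - y) &
      forall a x, I x -> I (a * x) /\ I (x * a)].

Lemma is_idealN I x : is_ideal I -> I x -> I (- x).
Proof. by case=> I0 IB _ Ix; rewrite -sub0r; apply: IB. Qed.

Lemma is_idealD I x y : is_ideal I -> I x -> I y -> I (x + y).
Proof.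
move=> idI Ix Iy; case: (idI) => _ IB _; rewrite -(opprK y).
by apply: IB => //; apply: is_idealN.
Qed.

Definition ideal_gen (S : set A) : set A :=
  [set x | forall I, is_ideal I -> S `<=` I -> I x].

Definition ideal_mul (I J : set A) : set A :=
  ideal_gen [set x * y | x in I & y in J].

Definition ideal_exp (J : set A) (n : nat) : set A :=
  iter n (fun I => ideal_mul I J) setT.

Lemma ideal_gen_ideal (S : set A) : is_ideal (ideal_gen S).
Proof.
split.
- by move=> I [].
- by move=> x y Sx Sy I idI SI; case: (idI) => _ B _; apply: B; [apply: Sx|apply: Sy].
- by move=> a x Sx; split=> I idI SI; case: (idI) => _ _ /(_ a x) M;
    case: M => //; apply: Sx.
Qed.

Lemma ideal_gen_sub (S : set A) : S `<=` ideal_gen S.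
Proof. by move=> x Sx I _; apply. Qed.

Lemma ideal_gen_id (I : set A) : is_ideal I -> ideal_gen I = I.
Proof.
move=> idI; apply/seteqP; split; last exact: ideal_gen_sub.
by move=> x; apply.
Qed.

Lemma ideal_exp_ideal (J : set A) n : is_ideal (ideal_exp J n).
Proof. by case: n => [|n]; [|exact: ideal_gen_ideal]. Qed.

Lemma ideal_exp_subS (J : set A) n : ideal_exp J n.+1 `<=` ideal_exp J n.
Proof.
have [_ _ M] := ideal_exp_ideal J n.
move=> x; apply; first exact: ideal_exp_ideal.
by move=> _ [y Iy [z _ <-]]; have [] := M z y Iy.
Qed.

Lemma ideal_exp_expr (J : set A) x n : J x -> ideal_exp J n (x ^+ n).
Proof.
move=> Jx; elim: n => [//|n IHn]; rewrite exprSr.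
by apply: ideal_gen_sub; exists (x ^+ n) => //; exists x.
Qed.

Definition ideal_pred (S : set A) : {pred A} := fun x => `[< ideal_gen S x >].

Lemma ideal_predE (S : set A) x : (x \in ideal_pred S) = `[< ideal_gen S x >].
Proof. by []. Qed.

Fact ideal_pred_zmod (S : set A) : zmod_closed (ideal_pred S).
Proof.
have [I0 IB _] := ideal_gen_ideal S.
split; first exact/asboolP.
by move=> x y /asboolP Ix /asboolP Iy; apply/asboolP; apply: IB.
Qed.
HB.instance Definition _ (S : set A) :=
  GRing.isZmodClosed.Build A (ideal_pred S) (ideal_pred_zmod S).

End Ideals.

(* [quot S] is the quotient of A by the two-sided ideal generated by S. *)
Section Quot.
Variables (k : comPzRingType) (A : algebraOver k) (S : set A).

Definition quot : Type := Quotient.quot (ideal_pred S).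
HB.instance Definition _ := GRing.Zmodule.on quot.
HB.instance Definition _ := EqQuotient.on quot.

Definition qproj (x : A) : quot := \pi_quot x.

Lemma qprojP (x y : A) : (qproj x = qproj y) <-> ideal_gen S (x - y).
Proof.
split=> [/eqP h|h].
  by apply/asboolP; move: h; rewrite /qproj -Quotient.idealrBE.
by apply/eqP; rewrite /qproj -Quotient.idealrBE; apply/asboolP.
Qed.

Lemma qrepr (u : quot) : qproj (repr u) = u.
Proof. exact: reprK. Qed.

Lemma qproj_surj (u : quot) : exists x, u = qproj x.
Proof. by exists (repr u); rewrite qrepr. Qed.

Fact qproj_zmod : zmod_morphism qproj.
Proof. by move=> x y; rewrite /qproj !piE. Qed.
HB.instance Definition _ :=
  GRing.isZmodMorphism.Build A quot qproj qproj_zmod.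

Definition qone : quot := qproj 1.
Definition qmul (u v : quot) : quot := qproj (repr u * repr v).

Lemma qmulE x y : qmul (qproj x) (qproj y) = qproj (x * y).
Proof.
have idI := ideal_gen_ideal S; have [_ _ IM] := idI.
apply/qprojP.
have hx : ideal_gen S (repr (qproj x) - x) by apply/qprojP; rewrite qrepr.
have hy : ideal_gen S (repr (qproj y) - y) by apply/qprojP; rewrite qrepr.
set x' := repr _ in hx *; set y' := repr _ in hy *.
have -> : x' * y' - x * y = (x' - x) * y' + x * (y' - y).
  by rewrite mulrBl mulrBr addrA subrK.
by apply: (is_idealD idI); [have [] := IM y' _ hx|have [] := IM x _ hy].
Qed.

Fact qmulA : associative qmul.
Proof.
by move=> u v w; rewrite -(qrepr u) -(qrepr v) -(qrepr w) !qmulE mulrA.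
Qed.
Fact qmul1 : left_id qone qmul.
Proof. by move=> u; rewrite -(qrepr u) qmulE mul1r. Qed.
Fact qmulr1 : right_id qone qmul.
Proof. by move=> u; rewrite -(qrepr u) qmulE mulr1. Qed.
Fact qmulDl : left_distributive qmul +%R.
Proof.
move=> u v w; rewrite -(qrepr u) -(qrepr v) -(qrepr w).
by rewrite -raddfD !qmulE -raddfD mulrDl.
Qed.
Fact qmulDr : right_distributive qmul +%R.
Proof.
move=> u v w; rewrite -(qrepr u) -(qrepr v) -(qrepr w).
by rewrite -raddfD !qmulE -raddfD mulrDr.
Qed.
HB.instance Definition _ :=
  GRing.Zmodule_isPzRing.Build quot qmulA qmul1 qmulr1 qmulDl qmulDr.

Fact qproj_monoid : monoid_morphism qproj.
Proof. by split=> // x y; rewrite -qmulE. Qed.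
HB.instance Definition _ :=
  GRing.isMonoidMorphism.Build A quot qproj qproj_monoid.

Definition qscal (c : k) : quot := qproj (scal c).
Fact qscal_zmod : zmod_morphism qscal.
Proof. by move=> x y; rewrite /qscal !raddfB. Qed.
Fact qscal_monoid : monoid_morphism qscal.
Proof. by split=> [|x y]; rewrite /qscal ?rmorph1 ?rmorphM. Qed.
Fact qscal_central c (u : quot) : qscal c * u = u * qscal c.
Proof.
by rewrite -(qrepr u) /qscal -[LHS]rmorphM -[RHS]rmorphM /= scal_central.
Qed.
HB.instance Definition _ :=
  PzRing_isAlgebraOver.Build k quot qscal_zmod qscal_monoid qscal_central.

End Quot.
Arguments qproj {k A S} x.

(* The inverse limit of the algebras B / J^n.  The transition map from B / J^(n+1)
   to B / J^n is computed on an arbitrary representative, see [transitionE]. *)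
Section Completion.
Variables (k : comPzRingType) (B : algebraOver k) (J : set B).

Definition tower (n : nat) := quot (ideal_exp J n).

Definition transition (n : nat) (u : tower n.+1) : tower n := qproj (repr u).

Definition coherent (x : forall n, tower n) : Prop :=
  forall n, transition (x n.+1) = x n.

Record completion := Completion {
  level :> forall n, tower n;
  level_coherent : `[< coherent level >]
}.
HB.instance Definition _ := [isSub for level].
HB.instance Definition _ := [Choice of completion by <:].

Lemma transitionE n (x : B) : transition (qproj x : tower n.+1) = qproj x.
Proof.
apply/qprojP; rewrite ideal_gen_id; last exact: ideal_exp_ideal.
apply: ideal_exp_subS; rewrite -[X in X _]ideal_gen_id; last first.
  exact: ideal_exp_ideal.
by apply/qprojP; rewrite qrepr.
Qed.

Lemma completion_ext (x y : completion) : (forall n, x n = y n) -> x = y.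
Proof. by move=> h; apply: val_inj; apply: functional_extensionality_dep. Qed.

Lemma coherentP (x : forall n, tower n) :
  (forall n, exists b, x n.+1 = qproj b /\ x n = qproj b) -> `[< coherent x >].
Proof.
by move=> h; apply/asboolP => n; have [b [-> ->]] := h n; rewrite transitionE.
Qed.

Lemma levelP (x : completion) n :
  x n.+1 = qproj (repr (x n.+1)) /\ x n = qproj (repr (x n.+1)).
Proof. by split; [rewrite qrepr|have /asboolP/(_ n) := level_coherent x]. Qed.

Definition cmap (b : B) : completion :=
  @Completion (fun n => qproj b)
    (coherentP (fun n => ex_intro _ b (conj erefl erefl))).

Fact copp_subproof (x : completion) : `[< coherent (fun n => - x n) >].
Proof.
apply: coherentP => n; have [h1 h2] := levelP x n.
by exists (- repr (x n.+1)); rewrite !raddfN /= -h1 -h2.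
Qed.
Definition copp x := Completion (copp_subproof x).

Fact cadd_subproof (x y : completion) : `[< coherent (fun n => x n + y n) >].
Proof.
apply: coherentP => n; have [h1 h2] := levelP x n; have [h3 h4] := levelP y n.
by exists (repr (x n.+1) + repr (y n.+1)); rewrite !raddfD /= -h1 -h2 -h3 -h4.
Qed.
Definition cadd x y := Completion (cadd_subproof x y).

Fact cmul_subproof (x y : completion) : `[< coherent (fun n => x n * y n) >].
Proof.
apply: coherentP => n; have [h1 h2] := levelP x n; have [h3 h4] := levelP y n.
by exists (repr (x n.+1) * repr (y n.+1)); rewrite !rmorphM /= -h1 -h2 -h3 -h4.
Qed.
Definition cmul x y := Completion (cmul_subproof x y).

Fact caddA : associative cadd.
Proof. by move=> x y z; apply: completion_ext => n; apply: addrA. Qed.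
Fact caddC : commutative cadd.
Proof. by move=> x y; apply: completion_ext => n; apply: addrC. Qed.
Fact cadd0 : left_id (cmap 0) cadd.
Proof. by move=> x; apply: completion_ext => n /=; rewrite raddf0 add0r. Qed.
Fact caddN : left_inverse (cmap 0) copp cadd.
Proof. by move=> x; apply: completion_ext => n /=; rewrite raddf0 addNr. Qed.
Fact cmulA : associative cmul.
Proof. by move=> x y z; apply: completion_ext => n; apply: mulrA. Qed.
Fact cmul1 : left_id (cmap 1) cmul.
Proof. by move=> x; apply: completion_ext => n /=; rewrite rmorph1 mul1r. Qed.
Fact cmulr1 : right_id (cmap 1) cmul.
Proof. by move=> x; apply: completion_ext => n /=; rewrite rmorph1 mulr1. Qed.
Fact cmulDl : left_distributive cmul cadd.
Proof. by move=> x y z; apply: completion_ext => n; apply: mulrDl. Qed.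
Fact cmulDr : right_distributive cmul cadd.
Proof. by move=> x y z; apply: completion_ext => n; apply: mulrDr. Qed.
HB.instance Definition _ := GRing.isPzRing.Build completion
  caddA caddC cadd0 caddN cmulA cmul1 cmulr1 cmulDl cmulDr.

Fact cmap_zmod : zmod_morphism cmap.
Proof. by move=> x y; apply: completion_ext => n /=; rewrite raddfB. Qed.
HB.instance Definition _ :=
  GRing.isZmodMorphism.Build B completion cmap cmap_zmod.
Fact cmap_monoid : monoid_morphism cmap.
Proof.
by split=> // x y; apply: completion_ext => n /=; rewrite rmorphM.
Qed.
HB.instance Definition _ :=
  GRing.isMonoidMorphism.Build B completion cmap cmap_monoid.

Definition cscal (c : k) : completion := cmap (scal c).
Fact cscal_zmod : zmod_morphism cscal.
Proof. by move=> x y; rewrite /cscal !raddfB. Qed.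
Fact cscal_monoid : monoid_morphism cscal.
Proof. by split=> [|x y]; rewrite /cscal ?rmorph1 ?rmorphM. Qed.
Fact cscal_central c (x : completion) : cscal c * x = x * cscal c.
Proof. by apply: completion_ext => n; apply: (@scal_central k (tower n)). Qed.
HB.instance Definition _ := PzRing_isAlgebraOver.Build k completion
  cscal_zmod cscal_monoid cscal_central.

End Completion.

Lemma exchange_triangle (V : nmodType) n (F : nat -> nat -> V) :
  \sum_(j < n) \sum_(i < j.+1) F i (j - i)%N =
  \sum_(i < n) \sum_(j < n - i) F i j.
Proof.
elim: n => [|n IHn]; first by rewrite !big_ord0.
rewrite big_ord_recr IHn /= [RHS]big_ord_recr /= subSnn big_ord1.
rewrite big_ord_recr /= subnn addrA; congr (_ + _).
rewrite -big_split /=; apply: eq_bigr => i _.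
by rewrite subSn 1?ltnW // big_ord_recr.
Qed.

(* Formal power series over k: [f n] is the coefficient of t^n. *)
Section PowerSeries.
Variable k : comPzRingType.

Definition pseries : Type := nat -> k.
HB.instance Definition _ := GRing.Zmodule.copy pseries (nat -> k).

Definition ps_one : pseries := fun n => (n == 0%N)%:R.
Definition ps_mul (f g : pseries) : pseries :=
  fun n => \sum_(i < n.+1) f i * g (n - i)%N.

Fact ps_mulC : commutative ps_mul.
Proof.
move=> f g; apply: funext => n; rewrite /ps_mul (reindex_inj rev_ord_inj) /=.
apply: eq_bigr => i _; rewrite subSS mulrC subKn //; exact: leq_ord.
Qed.
Fact ps_mulA : associative ps_mul.
Proof.
move=> f g h; apply: funext => n; rewrite /ps_mul.
under [RHS]eq_bigr do rewrite mulr_suml.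
transitivity (\sum_(i < n.+1) \sum_(j < n.+1 - i) f i * (g j * h (n - (i + j))%N)).
  apply: eq_bigr => i _; rewrite mulr_sumr -subSn; last exact: leq_ord.
  by apply: eq_bigr => j _; rewrite subnDA.
rewrite -(exchange_triangle n.+1 (fun i j => f i * (g j * h (n - (i + j))%N))).
apply: eq_bigr => j _; apply: eq_bigr => i _.
by rewrite subnKC ?mulrA //; exact: leq_ord.
Qed.
Fact ps_mul1 : left_id ps_one ps_mul.
Proof.
move=> f; apply: funext => n; rewrite /ps_mul big_ord_recl /= subn0 mul1r.
by rewrite big1 ?addr0 // => i _; rewrite mul0r.
Qed.
Fact ps_mulDl : left_distributive ps_mul +%R.
Proof.
move=> f g h; apply: funext => n.
rewrite /ps_mul [RHS]/GRing.add /= -big_split /=.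
by apply: eq_bigr => i _; rewrite -mulrDl.
Qed.
HB.instance Definition _ := GRing.Zmodule_isComPzRing.Build pseries
  ps_mulA ps_mulC ps_mul1 ps_mulDl.
End PowerSeries.

(* For b central in B and lying in J, the completion is an algebra over k[[t]]
   via t |-> b.  In B / J^n the powers b^i vanish for i >= n, so the value of
   a power series at b is a finite sum at each level. *)
Section AdicAlgebra.
Variables (k : comPzRingType) (B : algebraOver k) (J : set B) (b : B).

Definition adic_algebra (bJ : J b) (bC : forall x, b * x = x * b) : Type :=
  completion J.

Hypotheses (bJ : J b) (bC : forall x, b * x = x * b).
Local Notation adic := (adic_algebra bJ bC).

HB.instance Definition _ := GRing.PzRing.on adic.

Definition ps_trunc (f : pseries k) (n : nat) : B :=
  \sum_(i < n) scal (f i) * b ^+ i.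

Lemma qproj_pow0 n i : (n <= i)%N -> qproj (b ^+ i) = 0 :> tower J n.
Proof.
move=> /subnKC <-; rewrite exprD rmorphM /=.
suff -> : qproj (b ^+ n) = 0 :> tower J n by rewrite mul0r.
rewrite -(raddf0 qproj); apply/qprojP; rewrite subr0.
by apply: ideal_gen_sub; apply: ideal_exp_expr.
Qed.

Fact ps_eval_subproof (f : pseries k) :
  `[< coherent (fun n => qproj (ps_trunc f n) : tower J n) >].
Proof.
apply: coherentP => n; exists (ps_trunc f n.+1); split=> //.
by rewrite {2}/ps_trunc big_ord_recr /= raddfD /= rmorphM /= qproj_pow0 // mulr0 addr0.
Qed.
Definition ps_eval (f : pseries k) : adic :=
  Completion (ps_eval_subproof f).

Fact ps_eval_zmod : zmod_morphism ps_eval.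
Proof.
move=> f g; apply: completion_ext => n /=.
rewrite -raddfB /ps_trunc -sumrB; congr qproj; apply: eq_bigr => i _.
by rewrite -mulrBl -raddfB.
Qed.
Fact ps_eval_monoid : monoid_morphism ps_eval.
Proof.
split=> [|f g]; apply: completion_ext => n /=.
  case: n => [|n].
    by apply/qprojP; rewrite ideal_gen_id //; apply: ideal_exp_ideal.
  rewrite /ps_trunc big_ord_recl big1 ?addr0 => [|i _].
    by rewrite rmorph1 mulr1.
  by rewrite raddf0 mul0r.
rewrite -rmorphM /ps_trunc mulr_suml.
pose F i j := scal (f i) * b ^+ i * (scal (g j) * b ^+ j).
have FE i j : F i j = scal (f i * g j) * b ^+ (i + j).
  by rewrite /F rmorphM exprD !mulrA -(mulrA (scal (f i))) -scal_central !mulrA.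
transitivity (qproj (\sum_(i < n) \sum_(j < n - i) F i j) : tower J n).
  rewrite -exchange_triangle; congr qproj; apply: eq_bigr => i _.
  rewrite raddf_sum mulr_suml; apply: eq_bigr => j _.
  by rewrite FE subnKC //; exact: leq_ord.
rewrite !raddf_sum; apply: eq_bigr => i _; rewrite mulr_sumr !raddf_sum /=.
have -> : \sum_(j < n) (qproj (F i j) : tower J n) =
          \sum_(j < n | (j < n - i)%N) qproj (F i j).
  rewrite [RHS]big_mkcond /=; apply: eq_bigr => j _; case: ltnP => // nij.
  by rewrite FE rmorphM /= qproj_pow0 ?mulr0 // -leq_subLR.
by rewrite (big_ord_widen_cond n predT (fun j => qproj (F i j) : tower J n)) ?leq_subr.
Qed.
Fact ps_eval_central f (x : adic) : ps_eval f * x = x * ps_eval f.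
Proof.
apply: completion_ext => n /=; rewrite -[x n]qrepr -!rmorphM /=; congr qproj.
rewrite /ps_trunc mulr_suml mulr_sumr; apply: eq_bigr => i _.
have bX y : b ^+ i * y = y * b ^+ i.
  elim: (nat_of_ord i) => [|j IHj]; first by rewrite mul1r mulr1.
  by rewrite exprS -mulrA IHj mulrA bC mulrA.
by rewrite -mulrA bX mulrA scal_central mulrA.
Qed.
HB.instance Definition _ := PzRing_isAlgebraOver.Build (pseries k) adic
  ps_eval_zmod ps_eval_monoid ps_eval_central.
End AdicAlgebra.
Arguments adic_algebra {k B J b} bJ bC.

Record quiver := Quiver {
  vertex : finType;
  arrow : finType;
  source : arrow -> vertex;
  target : arrow -> vertex
}.

(* A path is a start vertex and a list of arrows in the order in which they are
   traversed, so that [(i, [:: a1; a2; a3])] is the path written a3 a2 a1. *)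
Section Paths.
Variable Q : quiver.

Fixpoint walk (i : vertex Q) (s : seq (arrow Q)) : bool :=
  if s is a :: s' then (source a == i) && walk (target a) s' else true.

Record qpath := QPath {
  path_data :> vertex Q * seq (arrow Q);
  path_walk : walk path_data.1 path_data.2
}.
HB.instance Definition _ := [isSub for path_data].
HB.instance Definition _ := [Choice of qpath by <:].

Definition plen (p : qpath) : nat := size (path_data p).2.

Definition pend (p : qpath) : vertex Q :=
  last (path_data p).1 [seq target a | a <- (path_data p).2].

Lemma walk_cat i s1 s2 :
  walk i (s1 ++ s2) = walk i s1 && walk (last i [seq target a | a <- s1]) s2.
Proof. by elim: s1 i => //= a s IHs i; rewrite IHs andbA. Qed.

Definition trivial_path (i : vertex Q) : qpath := @QPath (i, [::]) erefl.

Fact arrow_path_subproof (a : arrow Q) : walk (source a) [:: a].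
Proof. by rewrite /= eqxx. Qed.
Definition arrow_path (a : arrow Q) : qpath :=
  @QPath (source a, [:: a]) (arrow_path_subproof a).

Fact ptake_subproof n (p : qpath) : walk p.1 (take n p.2).
Proof.
by case: p => [[i s] /= h]; move: h; rewrite -{1}(cat_take_drop n s) walk_cat => /andP[].
Qed.
Definition ptake n (p : qpath) : qpath :=
  @QPath (p.1, take n p.2) (ptake_subproof n p).

Fact pdrop_subproof n (p : qpath) : walk (pend (ptake n p)) (drop n p.2).
Proof.
have := path_walk p.
by rewrite -{1}(cat_take_drop n p.2) walk_cat => /andP[].
Qed.
Definition pdrop n (p : qpath) : qpath :=
  @QPath (pend (ptake n p), drop n p.2) (pdrop_subproof n p).

Lemma ptake_ptake i j p : (i <= j)%N -> ptake i (ptake j p) = ptake i p.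
Proof. by move=> ij; apply: val_inj; rewrite /= take_takel. Qed.

Lemma pdrop_ptake i j p : pdrop i (ptake (i + j) p) = ptake j (pdrop i p).
Proof.
by apply: val_inj; rewrite /= /pend /= take_takel ?leq_addr // take_drop (addnC j).
Qed.

Lemma pdrop_pdrop i j p : pdrop j (pdrop i p) = pdrop (i + j) p.
Proof.
by apply: val_inj; rewrite /= drop_drop (addnC j) /pend /= takeD map_cat last_cat.
Qed.

Lemma ptake_all n p : (plen p <= n)%N -> ptake n p = p.
Proof. by case: p => [[i s] h] ?; apply: val_inj; rewrite /= take_oversize. Qed.

Lemma pdrop_0 p : pdrop 0 p = p.
Proof. by case: p => [[i s] h]; apply: val_inj; rewrite /= /pend /= take0 drop0. Qed.

Lemma plen_ptake n p : (n <= plen p)%N -> plen (ptake n p) = n.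
Proof. by move=> h; rewrite /plen /= size_takel. Qed.

Lemma plen_pdrop n p : plen (pdrop n p) = (plen p - n)%N.
Proof. by rewrite /plen /= size_drop. Qed.

Lemma cat_inj p n p' n' : (n <= plen p)%N -> (n' <= plen p')%N ->
  ptake n p = ptake n' p' -> pdrop n p = pdrop n' p' -> p = p'.
Proof.
case: p p' => [[i s] h] [[i' s'] h'] ns ns' [ii ss] [_ tt].
by apply: val_inj; rewrite /= ii -(cat_take_drop n s) ss tt cat_take_drop.
Qed.
End Paths.

Section PathAlgebra.
Variables (k : fieldType) (Q : quiver).

(* Formal combinations of paths with the convolution product; a product f * g
   is "first g, then f". *)
Definition pathfun : Type := qpath Q -> k.
HB.instance Definition _ := GRing.Zmodule.copy pathfun (qpath Q -> k).

Definition pf_one : pathfun := fun p => (plen p == 0%N)%:R.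
Definition pf_mul (f g : pathfun) : pathfun :=
  fun p => \sum_(j < (plen p).+1) f (pdrop j p) * g (ptake j p).

Fact pf_mulA : associative pf_mul.
Proof.
move=> f g h; apply: funext => p; rewrite /pf_mul.
transitivity (\sum_(j < (plen p).+1) \sum_(i < j.+1)
    f (pdrop j p) * (g (ptake (j - i) (pdrop i p)) * h (ptake i p))).
  apply: eq_bigr => j _; rewrite plen_ptake; last exact: leq_ord.
  rewrite mulr_sumr; apply: eq_bigr => i _.
  have ij : (i <= j)%N := leq_ord i.
  by rewrite -pdrop_ptake subnKC // ptake_ptake.
pose F i j := f (pdrop (i + j) p) * (g (ptake j (pdrop i p)) * h (ptake i p)).
transitivity (\sum_(j < (plen p).+1) \sum_(i < j.+1) F i (j - i)%N).
  apply: eq_bigr => j _; apply: eq_bigr => i _; rewrite /F subnKC //.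
  exact: leq_ord.
rewrite exchange_triangle; apply: eq_bigr => i _.
rewrite plen_pdrop -subSn ?leq_ord // mulr_suml; apply: eq_bigr => j _.
by rewrite /F pdrop_pdrop mulrA.
Qed.
Fact pf_mul1 : left_id pf_one pf_mul.
Proof.
move=> f; apply: funext => p; rewrite /pf_mul big_ord_recr /= big1 => [|j _].
  by rewrite /pf_one plen_pdrop subnn mul1r add0r ptake_all.
by rewrite /pf_one plen_pdrop subn_eq0 leqNgt ltn_ord mul0r.
Qed.
Fact pf_mulr1 : right_id pf_one pf_mul.
Proof.
move=> f; apply: funext => p; rewrite /pf_mul big_ord_recl /= big1 => [|j _].
  by rewrite /pf_one plen_ptake // mulr1 addr0 pdrop_0.
by rewrite /pf_one plen_ptake ?ltn_ord // mulr0.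
Qed.
Fact pf_mulDl : left_distributive pf_mul +%R.
Proof.
move=> f g h; apply: funext => p.
rewrite /pf_mul [RHS]/GRing.add /= -big_split /=.
by apply: eq_bigr => i _; rewrite -mulrDl.
Qed.
Fact pf_mulDr : right_distributive pf_mul +%R.
Proof.
move=> f g h; apply: funext => p.
rewrite /pf_mul [RHS]/GRing.add /= -big_split /=.
by apply: eq_bigr => i _; rewrite -mulrDr.
Qed.
HB.instance Definition _ := GRing.Zmodule_isPzRing.Build pathfun
  pf_mulA pf_mul1 pf_mulr1 pf_mulDl pf_mulDr.

Definition psupp (f : pathfun) : set (qpath Q) := [set p | f p != 0].
Definition finitely_supported : {pred pathfun} :=
  fun f => `[< finite_set (psupp f) >].

Record pathalg := PathAlg {
  pathfun_of : pathfun;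
  pathfun_fin : pathfun_of \in finitely_supported
}.
Definition coef (f : pathalg) : qpath Q -> k := pathfun_of f.
Coercion coef : pathalg >-> Funclass.
HB.instance Definition _ := [isSub for pathfun_of].
HB.instance Definition _ := [Choice of pathalg by <:].

Lemma finite_short n : finite_set [set p : qpath Q | (plen p <= n)%N].
Proof.
pose g (u : vertex Q * n.-bseq (arrow Q)) := (u.1, bseqval u.2).
have fr : finite_set (range g) by apply: finite_image; exact: finite_finset.
apply: sub_finite_set (finite_preimage _ fr); last first.
  by move=> p q _ _; exact: val_inj.
move=> p /= hp; exists (p.1, Bseq hp) => //; rewrite /g /=.
by case: (path_data p).
Qed.

Lemma finite_psuppP (f : pathfun) : finite_set (psupp f) <->
  exists n, forall p, (n < plen p)%N -> f p = 0.
Proof.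
split=> [/finite_seqP[s sE]|[n fn]].
  exists (\max_(p <- s) plen p) => p hp; apply/eqP; apply: contraTT hp => fp.
  have : p \in s by have : psupp f p by []; rewrite sE.
  by rewrite -leqNgt => ps; rewrite leq_bigmax_seq.
apply: sub_finite_set (finite_short n) => p /= fp.
by rewrite leqNgt; apply: contra_neqN fp => /fn.
Qed.

Fact finitely_supported_subring : subring_closed finitely_supported.
Proof.
split.
- by apply/asboolP/finite_psuppP; exists 0%N => p; rewrite lt0n => /negPf pn;
    rewrite /GRing.one /= /pf_one pn.
- move=> f g /asboolP/finite_psuppP[n fn] /asboolP/finite_psuppP[m gm].
  apply/asboolP/finite_psuppP; exists (maxn n m) => p; rewrite gtn_max.
  by case/andP=> /fn fp /gm gp; rewrite /GRing.add /= /GRing.opp /= fp gp subr0.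
- move=> f g /asboolP/finite_psuppP[n fn] /asboolP/finite_psuppP[m gm].
  apply/asboolP/finite_psuppP; exists (n + m)%N => p hp.
  rewrite /GRing.mul /= /pf_mul big1 // => j _.
  have jp : (j <= plen p)%N := leq_ord j.
  have [mj|jm] := ltnP m j; first by rewrite (gm (ptake j p)) ?plen_ptake ?mulr0.
  rewrite fn ?mul0r // plen_pdrop ltn_subRL (leq_ltn_trans _ hp) // addnC.
  by rewrite leq_add2l.
Qed.
HB.instance Definition _ :=
  GRing.SubChoice_isSubPzRing.Build pathfun finitely_supported pathalg
    finitely_supported_subring.

Lemma coef_eq (f g : pathalg) : (forall p, f p = g p) -> f = g.
Proof. by move=> h; apply: val_inj; apply: funext. Qed.

Lemma coefM (f g : pathalg) p :
  (f * g) p = \sum_(j < (plen p).+1) f (pdrop j p) * g (ptake j p).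
Proof. by []. Qed.

Fact pa_scal_subproof (c : k) :
  (fun p => if plen p == 0%N then c else 0) \in finitely_supported.
Proof.
apply/asboolP/finite_psuppP; exists 0%N => p.
by rewrite lt0n => /negPf ->.
Qed.
Definition pa_scal (c : k) : pathalg := PathAlg (pa_scal_subproof c).

Lemma pa_scalM c (f : pathalg) p : (pa_scal c * f) p = c * f p.
Proof.
rewrite coefM big_ord_recr /= big1 => [|j _].
  by rewrite plen_pdrop subnn add0r ptake_all.
by rewrite plen_pdrop subn_eq0 leqNgt ltn_ord mul0r.
Qed.
Lemma pa_Mscal c (f : pathalg) p : (f * pa_scal c) p = f p * c.
Proof.
rewrite coefM big_ord_recl /= big1 => [|j _].
  by rewrite plen_ptake // pdrop_0 addr0.
by rewrite plen_ptake ?ltn_ord // mulr0.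
Qed.

Fact pa_scal_zmod : zmod_morphism pa_scal.
Proof.
move=> x y; apply: coef_eq => p /=.
rewrite [RHS]/GRing.add /= /GRing.opp /=.
by case: ifP => // _; rewrite subr0.
Qed.
Fact pa_scal_monoid : monoid_morphism pa_scal.
Proof.
split=> [|x y]; apply: coef_eq => p.
  by rewrite /= [RHS]/GRing.one /= /pf_one; case: ifP.
by rewrite pa_scalM /=; case: ifP => // _; rewrite mulr0.
Qed.
Fact pa_scal_central c (f : pathalg) : pa_scal c * f = f * pa_scal c.
Proof. by apply: coef_eq => p; rewrite pa_scalM pa_Mscal mulrC. Qed.
HB.instance Definition _ := PzRing_isAlgebraOver.Build k pathalg
  pa_scal_zmod pa_scal_monoid pa_scal_central.

Fact pelt_subproof (p : qpath Q) :
  (fun q => (q == p)%:R) \in finitely_supported.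
Proof.
apply/asboolP/finite_psuppP; exists (plen p) => q pq.
by case: eqP pq => // ->; rewrite ltnn.
Qed.
Definition pelt (p : qpath Q) : pathalg := PathAlg (pelt_subproof p).

Definition vtx (i : vertex Q) : pathalg := pelt (trivial_path i).
Definition arr (a : arrow Q) : pathalg := pelt (arrow_path a).

Lemma peltE p q : pelt p q = (q == p)%:R. Proof. by []. Qed.

Lemma pelt_cat n p : (n <= plen p)%N -> pelt (pdrop n p) * pelt (ptake n p) = pelt p.
Proof.
move=> np; apply: coef_eq => q; rewrite coefM peltE.
have [->|qp] := eqVneq q p.
  rewrite (bigD1 (Ordinal (np : n < (plen p).+1)%N)) //= !eqxx mulr1 big1 ?addr0 //.
  move=> j /eqP jn; rewrite [X in _ * X](_ : _ = 0) ?mulr0 //.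
  case: eqP => // /(congr1 (@plen Q)); rewrite !plen_ptake //; last exact: leq_ord.
  by move=> ejn; case: jn; apply: val_inj.
rewrite big1 // => j _; rewrite !peltE.
case: eqP => [e1|]; last by rewrite mul0r.
case: eqP => [e2|]; last by rewrite mulr0.
by move/eqP: qp; case; apply: (cat_inj (leq_ord j) np).
Qed.

Lemma pelt_mul0 (p q : qpath Q) : pend q != p.1 -> pelt p * pelt q = 0.
Proof.
move=> pq; apply: coef_eq => r; rewrite coefM big1 // => j _; rewrite !peltE.
case: eqP => [e1|]; last by rewrite mul0r.
case: eqP => [e2|]; last by rewrite mulr0.
by move: pq; rewrite -e1 -e2 /= eqxx.
Qed.

Lemma arr_vtx a i : arr a * vtx i = if source a == i then arr a else 0.
Proof.
have [<-|ai] := eqVneq; last by rewrite pelt_mul0 // eq_sym.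
rewrite /arr -[RHS](@pelt_cat 0) //; congr (pelt _ * pelt _).
  by rewrite pdrop_0.
exact: val_inj.
Qed.

Lemma vtx_arr a i : vtx i * arr a = if target a == i then arr a else 0.
Proof.
have [<-|ai] := eqVneq; last by rewrite pelt_mul0.
by rewrite /arr -[RHS](@pelt_cat 1) //; congr (pelt _ * pelt _); apply: val_inj.
Qed.

Lemma pelt_ind (P : pathalg -> Prop) : (forall i, P (vtx i)) ->
  (forall a, P (arr a)) -> (forall x y, P x -> P y -> P (x * y)) ->
  forall p, P (pelt p).
Proof.
move=> Pv Pa PM p.
elim: {p}_.+1 {-2}p (ltnSn (plen p)) => // n IHn p hp.
have [p0|p0] := posnP (plen p).
  suff -> : p = trivial_path p.1 by apply: Pv.
  by apply: val_inj => /=; case: p p0 {hp} => [[i [|]]].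
rewrite -(@pelt_cat 1) //; apply: PM.
  by apply: IHn; rewrite plen_pdrop ltn_subLR // ltnS.
have [a ->] : exists a, ptake 1 p = arrow_path a.
  case: p p0 {hp} => [[i [|a s]] /= h] // _; exists a; apply: val_inj => /=.
  by case/andP: (h) => /eqP <-; rewrite take0.
exact: Pa.
Qed.

Lemma pathalg_ind (P : pathalg -> Prop) :
  P 0 -> (forall x y, P x -> P y -> P (x + y)) ->
  (forall c x, P x -> P (scal c * x)) -> (forall p, P (pelt p)) ->
  forall f, P f.
Proof.
move=> P0 PD PZ Pp f.
have /asboolP/finite_seqP[s0 s0E] := pathfun_fin f.
pose s := undup s0.
suff -> : f = \sum_(p <- s) scal (f p) * pelt p.
  by elim/big_rec: _ => // p x _ Px; apply: PD => //; apply: PZ.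
apply: coef_eq => q.
have -> : (\sum_(p <- s) scal (f p) * pelt p) q = \sum_(p <- s) f p * (q == p)%:R.
  elim: s => [|p s' IHs]; first by rewrite !big_nil.
  have e : (scal (f p) * pelt p) q = f p * (q == p)%:R := pa_scalM _ _ _.
  by rewrite !big_cons -IHs -e.
have [qs|qs] := boolP (q \in s).
  rewrite (bigD1_seq q) ?undup_uniq //= eqxx mulr1 big1 ?addr0 // => p pq.
  by rewrite eq_sym (negPf pq) mulr0.
have -> : f q = 0.
  apply/eqP; apply: contraNT qs => fq; rewrite mem_undup.
  by have : psupp f q by []; rewrite s0E.
rewrite big_seq big1 // => p ps; case: eqP ps => [<-|]; last by rewrite mulr0.
by rewrite (negPf qs).
Qed.

End PathAlgebra.
Arguments pelt {k Q} p.
Arguments vtx {k Q} i.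
Arguments arr {k Q} a.

Section Gentle.
Variables (k : fieldType) (Q : quiver) (I : set (pathalg k Q)).

Definition complete_gentle : Prop :=
  [/\ forall i : vertex Q, #|[pred a : arrow Q | source a == i]| = 2%N /\
                           #|[pred a : arrow Q | target a == i]| = 2%N,
      forall b : arrow Q, (exists! c, ~ I (arr c * arr b)) /\
                          (exists! a, ~ I (arr b * arr a)) &
      exists2 S : set (qpath Q), (forall p, S p -> plen p = 2%N) &
                                 I = ideal_gen [set pelt p | p in S]].

(* The unique arrow c with c b not in I, if there is one. *)
Definition sigma (b : arrow Q) : arrow Q :=
  odflt b [pick c | `[< ~ I (arr c * arr b) >]].

Definition sorbit (a : arrow Q) : {set arrow Q} := finset (mem (orbit sigma a)).

Definition sorbits : Type :=
  {v : {set arrow Q} | [exists a, v == sorbit a]}.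

Fact sorbit_of_subproof a : [exists b, sorbit a == sorbit b].
Proof. by apply/existsP; exists a. Qed.
Definition sorbit_of (a : arrow Q) : sorbits :=
  exist (fun v => is_true [exists b, v == sorbit b]) _ (sorbit_of_subproof a).

(* [orbit sigma a] lists a, sigma a, ..., sigma^(n(a)-1) a. *)
Definition cyc (a : arrow Q) : pathalg k Q :=
  \prod_(b <- rev (orbit sigma a)) arr b.

Definition arrow_ideal : set (quot I) :=
  ideal_gen [set qproj (arr a) | a in [set: arrow Q]].

Definition ribbon_algebra := completion arrow_ideal.

Definition of_path (x : pathalg k Q) : ribbon_algebra := cmap arrow_ideal (qproj x).

Definition zquot (m : sorbits -> nat) : quot I :=
  \sum_(a : arrow Q) qproj (cyc a) ^+ m (sorbit_of a).

Definition zelt (m : sorbits -> nat) : ribbon_algebra :=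
  \sum_(a : arrow Q) of_path (cyc a) ^+ m (sorbit_of a).

Lemma zeltE m : zelt m = cmap arrow_ideal (zquot m).
Proof.
by rewrite /zquot rmorph_sum; apply: eq_bigr => a _; rewrite rmorphXn.
Qed.

Section Consequences.
Hypothesis gentleI : complete_gentle.

Lemma gentle_ideal : is_ideal I.
Proof. by case: gentleI => _ _ [S _ ->]; apply: ideal_gen_ideal. Qed.

Lemma sigmaP b : ~ I (arr (sigma b) * arr b).
Proof.
rewrite /sigma; case: pickP => [c /asboolP //|h].
case: gentleI => _ /(_ b)[[c [nI _]] _] _.
by have /asboolP := h c.
Qed.

Lemma sigma_uniq b c : ~ I (arr c * arr b) -> c = sigma b.
Proof.
case: gentleI => _ /(_ b)[[d [_ d_uniq]] _] _ nI.
by rewrite -(d_uniq _ nI); apply: d_uniq; apply: sigmaP.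
Qed.

Lemma sigma_inj : injective sigma.
Proof.
move=> b b' e; case: gentleI => _ /(_ (sigma b))[_ [d [_ d_uniq]]] _.
rewrite -(d_uniq b (@sigmaP b)); apply: d_uniq.
by rewrite e; apply: sigmaP.
Qed.

Lemma source_sigma b : source (sigma b) = target b.
Proof.
have [e|ne] := eqVneq (target b) (source (sigma b)); first by [].
case: (@sigmaP b); rewrite /arr pelt_mul0 //.
by case: gentle_ideal.
Qed.

Lemma qproj_eq0 (x : pathalg k Q) : qproj x = 0 :> quot I <-> I x.
Proof.
rewrite -(raddf0 qproj) qprojP subr0 ideal_gen_id //; exact: gentle_ideal.
Qed.

Lemma orbit_sigma a :
  orbit sigma a = a :: traject sigma (sigma a) (order sigma a).-1.
Proof. by rewrite /orbit -orderSpred. Qed.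

Lemma order_sigma a : order sigma (sigma a) = order sigma a.
Proof.
apply: eq_card => x; rewrite inE; apply/idP/idP.
  by apply: connect_trans; apply: fconnect1.
apply: connect_trans; rewrite (fconnect_sym sigma_inj); exact: fconnect1.
Qed.

Lemma orbit_sigmaS a : orbit sigma (sigma a) =
  rcons (traject sigma (sigma a) (order sigma a).-1) a.
Proof.
rewrite /orbit order_sigma -orderSpred trajectSr; congr rcons.
by rewrite -iterSr orderSpred (iter_order sigma_inj).
Qed.

Lemma cycE a : cyc a =
  (\prod_(b <- rev (traject sigma (sigma a) (order sigma a).-1)) arr b) * arr a.
Proof. by rewrite /cyc orbit_sigma rev_cons -cats1 big_cat /= big_seq1. Qed.

Variable m : sorbits -> nat.
Hypothesis m_gt0 : forall v, (0 < m v)%N.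

Lemma zquot_arrow : arrow_ideal (zquot m).
Proof.
have idJ : is_ideal arrow_ideal by apply: ideal_gen_ideal.
rewrite /zquot; elim/big_rec: _ => [|a x _ Jx]; first by case: idJ.
apply: (is_idealD idJ) => //; rewrite -(prednK (m_gt0 (sorbit_of a))) exprSr.
have [_ _ M] := idJ; have ML y u : arrow_ideal u -> arrow_ideal (y * u).
  by case/(M y).
apply: (ML (qproj (cyc a) ^+ (m (sorbit_of a)).-1)).
rewrite cycE rmorphM; apply: ML.
by apply: ideal_gen_sub; exists a.
Qed.

Lemma qproj_arr_arr a b : a != sigma b -> qproj (arr a) * qproj (arr b) = 0 :> quot I.
Proof.
move=> ab; rewrite -rmorphM; apply/qproj_eq0.
by apply: contrapT => /sigma_uniq e; rewrite e eqxx in ab.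
Qed.

Lemma cyc_sigma b : cyc (sigma b) * arr b = arr b * cyc b.
Proof.
by rewrite [in RHS]cycE mulrA /cyc orbit_sigmaS rev_rcons big_cons.
Qed.

Lemma cycX_sigma b n : cyc (sigma b) ^+ n * arr b = arr b * cyc b ^+ n.
Proof.
elim: n => [|n IHn]; first by rewrite mul1r mulr1.
by rewrite exprS -mulrA IHn mulrA cyc_sigma -mulrA -exprS.
Qed.

Lemma sorbit_sigma b : sorbit_of (sigma b) = sorbit_of b.
Proof.
apply: val_inj; apply/setP => x; rewrite !inE -!fconnect_orbit.
by rewrite -(same_fconnect1 sigma_inj).
Qed.

Lemma cycE_last a : exists2 c, sigma c = a & exists x, cyc a = arr c * x.
Proof.
have e := f_finv sigma_inj a; exists (finv sigma a) => //.
move: (finv sigma a) e => c <-; rewrite /cyc orbit_sigmaS rev_rcons big_cons.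
by eexists.
Qed.

Lemma zquot_mul_arr b : zquot m * qproj (arr b) =
  qproj (cyc (sigma b)) ^+ m (sorbit_of b) * qproj (arr b).
Proof.
rewrite /zquot mulr_suml (bigD1 (sigma b)) //= big1 ?addr0 ?sorbit_sigma //.
move=> a ab; rewrite -(prednK (m_gt0 (sorbit_of a))) exprSr -mulrA.
by rewrite cycE rmorphM /= -!mulrA qproj_arr_arr ?mulr0.
Qed.

Lemma arr_mul_zquot b : qproj (arr b) * zquot m =
  qproj (arr b) * qproj (cyc b) ^+ m (sorbit_of b).
Proof.
rewrite /zquot mulr_sumr (bigD1 b) //= big1 ?addr0 //.
move=> a ab; rewrite -(prednK (m_gt0 (sorbit_of a))) exprS mulrA.
have [c ca [x ->]] := cycE_last a.
rewrite rmorphM /= mulrA qproj_arr_arr ?mul0r // ca eq_sym; exact: ab.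
Qed.

Lemma cyc_vtx a i : cyc a * vtx i = if source a == i then cyc a else 0.
Proof. by rewrite cycE -mulrA arr_vtx; case: ifP; rewrite ?mulr0. Qed.

Lemma vtx_cyc a i : vtx i * cyc a = if source a == i then cyc a else 0.
Proof.
have [c ca [x ->]] := cycE_last a.
by rewrite mulrA vtx_arr -source_sigma ca; case: ifP; rewrite ?mul0r.
Qed.

Lemma zquot_central x : zquot m * x = x * zquot m.
Proof.
have [f ->] := qproj_surj x; elim/pathalg_ind: f.
- by rewrite raddf0 mul0r mulr0.
- by move=> f g; rewrite raddfD mulrDl mulrDr => -> ->.
- move=> c f; rewrite rmorphM /= mulrA => h.
  have e : zquot m * qproj (scal c) = qproj (scal c) * zquot m.
    by symmetry; apply: (@scal_central k (quot I)).
  by rewrite e -!mulrA h.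
apply: (@pelt_ind k Q (fun f => zquot m * qproj f = qproj f * zquot m)).
- move=> i; rewrite /zquot mulr_suml mulr_sumr; apply: eq_bigr => a _.
  rewrite -(prednK (m_gt0 (sorbit_of a))) {1}exprSr exprS -mulrA [RHS]mulrA.
  rewrite -!rmorphM /= -/(vtx i) cyc_vtx vtx_cyc.
  by case: ifP => _; rewrite ?raddf0 ?mulr0 ?mul0r // -exprS -exprSr.
- move=> b; rewrite -/(arr b) zquot_mul_arr arr_mul_zquot.
  by rewrite -!rmorphXn -!rmorphM /= cycX_sigma.
- by move=> f g hf hg; rewrite rmorphM /= mulrA hf -!mulrA hg.
Qed.

End Consequences.
End Gentle.
Arguments arrow_ideal {k Q} I.

(* [ribbon_order] is the ring [ribbon_algebra I] seen as an algebra over k[[t]]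
   via t |-> z, see [scal_t]. *)
Section RibbonOrder.
Variables (k : fieldType) (Q : quiver) (I : set (pathalg k Q)).
Variable m : sorbits I -> nat.

Definition ribbon_order (gentleI : complete_gentle I)
    (m_gt0 : forall v, (0 < m v)%N) : Type :=
  adic_algebra (zquot_arrow m_gt0) (zquot_central gentleI m_gt0).

Hypotheses (gentleI : complete_gentle I) (m_gt0 : forall v, (0 < m v)%N).
HB.instance Definition _ := AlgebraOver.on (ribbon_order gentleI m_gt0).

Definition ps_t : pseries k := fun n => (n == 1%N)%:R.

Lemma scal_t : scal ps_t = zelt m :> ribbon_order gentleI m_gt0.
Proof.
rewrite zeltE; apply: completion_ext => n.
change (qproj (ps_trunc (zquot m) ps_t n) = qproj (zquot m) :> tower (arrow_ideal I) n).
case: n => [|[|n]].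
- by apply/qprojP; rewrite ideal_gen_id //; apply: ideal_exp_ideal.
- rewrite /ps_trunc big_ord1 /= raddf0 mul0r raddf0.
  by rewrite (@qproj_pow0 _ _ _ _ (zquot_arrow m_gt0) 1 1).
rewrite /ps_trunc big_ord_recl /= raddf0 mul0r add0r big_ord_recl /=.
rewrite rmorph1 mul1r big1 ?addr0 // => i _.
by rewrite raddf0 mul0r.
Qed.

End RibbonOrder.

Section AlgebraNotions.
Variable R : comPzRingType.

Definition is_alg_morphism (A B : algebraOver R) (f : A -> B) : Prop :=
  [/\ zmod_morphism f, monoid_morphism f & forall c : R, f (scal c) = scal c].

Definition alg_isomorphic (A B : algebraOver R) : Prop :=
  exists2 f : A -> B, is_alg_morphism f & bijective f.

Definition finite_dimensional (A : algebraOver R) : Prop :=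
  exists n (g : 'I_n -> A), forall x, exists c : 'I_n -> R,
    x = \sum_i scal (c i) * g i.

End AlgebraNotions.

Section Polarization.
Variables (k : fieldType) (Q : quiver) (I : set (pathalg k Q)).

(* [true] stands for + and [false] for -. *)
Definition polarization (eps : arrow Q -> bool) : Prop :=
  forall a b, a != b -> source a = source b -> eps a != eps b.

Definition signed (V : zmodType) (e : bool) (x : V) : V := if e then x else - x.

Variables (gentleI : complete_gentle I) (m : sorbits I -> nat).
Variables (m_gt0 : forall v, (0 < m v)%N) (eps : arrow Q -> bool).
Local Notation Lambda := (ribbon_order gentleI m_gt0).

Definition is_polar_involution (f : Lambda -> Lambda) : Prop :=
  [/\ is_alg_morphism f,
      forall i : vertex Q, f (of_path I (vtx i)) = of_path I (vtx i) &
      forall a : arrow Q, f (of_path I (arr a)) =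
        signed (eps (sigma I a)) (signed (eps a) (of_path I (arr a)))].

(* [Lambda] is an algebra over k[[t]] here, so [is_alg_morphism] is relative to
   k[[t]].  The default [id] of [xget] is irrelevant, as such a map exists. *)
Definition polar_involution : Lambda -> Lambda :=
  xget (id : Lambda -> Lambda) [set f | is_polar_involution f].

End Polarization.
Arguments is_polar_involution {k Q I} gentleI {m} m_gt0 eps f.
Arguments polar_involution {k Q I} gentleI {m} m_gt0 eps _.

Record bimodule (A : pzRingType) := Bimodule {
  bimod_sort :> zmodType;
  lact : A -> bimod_sort -> bimod_sort;
  ract : bimod_sort -> A -> bimod_sort;
  lactA : forall a b x, lact a (lact b x) = lact (a * b) x;
  lact1 : forall x, lact 1 x = x;
  lactDr : forall a x y, lact a (x + y) = lact a x + lact a y;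
  lactDl : forall a b x, lact (a + b) x = lact a x + lact b x;
  ractA : forall x a b, ract (ract x a) b = ract x (a * b);
  ract1 : forall x, ract x 1 = x;
  ractDl : forall x y a, ract (x + y) a = ract x a + ract y a;
  ractDr : forall x a b, ract x (a + b) = ract x a + ract x b;
  lract : forall a x b, ract (lact a x) b = lact a (ract x b)
}.

Definition bimod_isomorphic (A : pzRingType) (M N : bimodule A) : Prop :=
  exists f : M -> N, [/\ bijective f, {morph f : x y / x + y},
    forall a x, f (lact a x) = lact a (f x) &
    forall x a, f (ract x a) = ract (f x) a].

Definition twisted_bimod (A : pzRingType) (s : {rmorphism A -> A}) : bimodule A.
Proof.
apply: (@Bimodule A A (fun a x => a * x) (fun x a => x * s a)).
- exact: mulrA.
- exact: mul1r.
- exact: mulrDr.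
- by move=> a b x; rewrite mulrDl.
- by move=> x a b; rewrite rmorphM mulrA.
- by move=> x; rewrite rmorph1 mulr1.
- by move=> x y a; rewrite mulrDl.
- by move=> x a b; rewrite rmorphD mulrDr.
- by move=> a x b; rewrite mulrA.
Defined.

Definition regular_bimod (A : pzRingType) : bimodule A :=
  twisted_bimod (idfun : {rmorphism A -> A}).

Section Dual.
Variables (R : comPzRingType) (A : algebraOver R).

Definition is_form : {pred A -> R} := fun f =>
  `[< zmod_morphism f /\ forall c x, f (scal c * x) = c * f x >].

(* Hom_R(A, R), with (a f)(x) = f(x a) and (f a)(x) = f(a x). *)
Record dual := Dual { dual_fun :> A -> R; dual_form : dual_fun \in is_form }.
HB.instance Definition _ := [isSub for dual_fun].
HB.instance Definition _ := [Choice of dual by <:].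

Fact is_form_zmod : zmod_closed is_form.
Proof.
split; first by apply/asboolP; split=> [x y|c x] /=; rewrite ?subr0 ?mulr0.
move=> f g /asboolP[fB fZ] /asboolP[gB gZ]; apply/asboolP; split.
  move=> x y; change (f (x - y) - g (x - y) = (f x - g x) - (f y - g y)).
  by rewrite fB gB !opprD !opprK addrACA.
move=> c x; change (f (scal c * x) - g (scal c * x) = c * (f x - g x)).
by rewrite fZ gZ mulrBr.
Qed.
HB.instance Definition _ :=
  GRing.SubChoice_isSubZmodule.Build (A -> R) is_form dual is_form_zmod.

Lemma dual_ext (f g : dual) : (forall x, f x = g x) -> f = g.
Proof. by move=> h; apply: val_inj; apply: funext. Qed.

Lemma dualB (f : dual) : zmod_morphism f.
Proof. by case: f => f h; case/asboolP: (h). Qed.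
Lemma dualZ (f : dual) c x : f (scal c * x) = c * f x.
Proof. by case: f => f h; case/asboolP: (h). Qed.
Lemma dualD (f : dual) x y : f (x + y) = f x + f y.
Proof.
have f0 : f 0 = 0 by rewrite -(subrr 0) dualB subrr.
by rewrite -[y in LHS]opprK -(sub0r y) !dualB f0 sub0r opprK.
Qed.

Fact dual_lact_subproof a (f : dual) : (fun x => f (x * a)) \in is_form.
Proof.
apply/asboolP; split=> [x y|c x]; first by rewrite mulrBl dualB.
by rewrite -mulrA dualZ.
Qed.
Definition dual_lact a f : dual := Dual (dual_lact_subproof a f).

Fact dual_ract_subproof a (f : dual) : (fun x => f (a * x)) \in is_form.
Proof.
apply/asboolP; split=> [x y|c x]; first by rewrite mulrBr dualB.
by rewrite mulrA -scal_central -mulrA dualZ.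
Qed.
Definition dual_ract f a : dual := Dual (dual_ract_subproof a f).

Definition dual_bimod : bimodule A.
Proof.
apply: (@Bimodule A dual dual_lact dual_ract).
- by move=> a b f; apply: dual_ext => x /=; rewrite mulrA.
- by move=> f; apply: dual_ext => x /=; rewrite mulr1.
- by move=> a f g; apply: dual_ext.
- by move=> a b f; apply: dual_ext => x /=; rewrite mulrDr dualD.
- by move=> f a b; apply: dual_ext => x /=; rewrite mulrA.
- by move=> f; apply: dual_ext => x /=; rewrite mul1r.
- by move=> f g a; apply: dual_ext.
- by move=> f a b; apply: dual_ext => x /=; rewrite mulrDl dualD.
- by move=> a f b; apply: dual_ext => x /=; rewrite mulrA.
Defined.

Definition symmetric_algebra : Prop :=
  bimod_isomorphic (regular_bimod A) dual_bimod.

End Dual.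

(* Morita equivalence of k-algebras is a k-linear equivalence between the
   categories of finitely generated left modules. *)
Section Morita.
Variable k : comPzRingType.

Record fgmod (A : pzRingType) := FgMod {
  fgmod_sort :> lmodType A;
  fgmod_gen : exists n (g : 'I_n -> fgmod_sort), forall x,
    exists c : 'I_n -> A, x = \sum_i c i *: g i
}.

Record mod_functor (A B : algebraOver k) := ModFunctor {
  fobj :> fgmod A -> fgmod B;
  fmap : forall M N : fgmod A, {linear M -> N} -> {linear fobj M -> fobj N};
  fmap_id : forall (M : fgmod A) (f : {linear M -> M}), f =1 id -> fmap f =1 id;
  fmap_comp : forall (M N P : fgmod A) (g : {linear N -> P}) (f : {linear M -> N})
    (h : {linear M -> P}), h =1 g \o f -> fmap h =1 fmap g \o fmap f;
  fmap_linear : forall (M N : fgmod A) (c : k) (f g h : {linear M -> N}),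
    (forall x, h x = (scal c : A) *: f x + g x) ->
    forall y, fmap h y = (scal c : B) *: fmap f y + fmap g y
}.

Definition left_quasi_inverse (A B : algebraOver k)
    (F : mod_functor A B) (G : mod_functor B A) : Prop :=
  exists eta : forall M : fgmod A, {linear M -> G (F M)},
    (forall M, bijective (eta M)) /\
    (forall (M N : fgmod A) (f : {linear M -> N}),
       eta N \o f =1 fmap G (fmap F f) \o eta M).

Definition morita_equivalent (A B : algebraOver k) : Prop :=
  exists (F : mod_functor A B) (G : mod_functor B A),
    left_quasi_inverse F G /\ left_quasi_inverse G F.
End Morita.

Section BrauerGraphAlgebra.
Variable k : fieldType.

Definition Jminus (Q : quiver) (I : set (pathalg k Q)) (m : sorbits I -> nat) :
    set (pathalg k Q) :=
  ideal_gen [set x | exists a b : arrow Q, source a = source b /\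
    x = cyc I a ^+ m (sorbit_of I a) - cyc I b ^+ m (sorbit_of I b)].

Definition is_brauer_graph_algebra (B : algebraOver k) : Prop :=
  finite_dimensional B /\
  exists (Q : quiver) (I : set (pathalg k Q)) (m : sorbits I -> nat),
    [/\ complete_gentle I, forall v, (0 < m v)%N &
        morita_equivalent B (quot [set x + y | x in I & y in Jminus m])].

End BrauerGraphAlgebra.

Definition twisted_brauer_algebra (k : fieldType) (Q : quiver)
    (I : set (pathalg k Q)) (m : sorbits I -> nat) :=
  quot [set zelt m * x | x in [set: ribbon_algebra I]].

(* Main.v *)
Require Import Defs.
From HB Require Import structures.
From mathcomp Require Import all_boot all_order all_algebra generic_quotient.
From mathcomp Require Import boolp classical_sets functions cardinality.

Set Implicit Arguments.
Unset Strict Implicit.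
Unset Printing Implicit Defensive.

Import GRing.Theory.
Local Open Scope classical_set_scope.
Local Open Scope ring_scope.

(** Every element of Lambda is a unique, possibly infinite, combination of the
   idempotents and of the paths P_a^l = sigma^(l-1)(a) ... sigma(a) a, one for
   each arrow a and each length l > 0.  Put N(a) = n(a) m(v_a), so that z is the
   sum of the P_a^N(a) and z P_a^l = P_a^(l+N(a)).  Reading off coefficients
   ([twisted_brauer_kernel]), x lies in z Lambda if and only if its coefficients
   below length N(a) vanish and x(P_a^N(a)) = x(P_b^N(b)) whenever the arrows a
   and b start at the same vertex.  As a polarization gives a and b opposite
   signs, the form
     phi(x) = sum_a eps_a x(P_a^N(a))
   vanishes on z Lambda and descends to A.  For 0 < l <= N(a), put
   b = sigma^l(a).  The path P_a^l pairs only with its complement P_b^(N(a)-l):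
     phi(P_a^l y) = eps_b y(P_b^(N(a)-l)),  phi(y P_a^l) = eps_a y(P_b^(N(a)-l)),
   and the idempotents pair with the socle.  So phi is nondegenerate, and
   exchanging the factors costs the sign eps_a eps_b, by which the involution
   acts on P_a^l, the intermediate signs cancelling in pairs.  Hence
   phi(x y) = phi(y ebar(x)), which is the isomorphism between A^* and the
   twist of A by ebar.

   If Lambda is symmetric, with symmetrizing form theta, then phi lifts to the
   k[[t]]-linear form Phi(x) = sum_n sum_a eps_a x(P_a^((n+1)N(a))) t^n.  So
   Phi = theta(- u) for some u, and the reduction of theta modulo t is a trace
   form on A, one multiple of which is phi; it therefore is nondegenerate
   ([frobenius_of_tracial_multiple], [symmetric_order_reduction]).

   For kQ'/(I' + J_-) the same computation applies with all weights 1, since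
   there the two cycles at a vertex are identified with sign +; with constant
   weights no twist appears, so this algebra is symmetric
   ([brauer_quotient_symmetric]).  Symmetry is Morita invariant
   ([morita_symmetric]): an equivalence sends the regular module to a finitely
   generated projective module P over a symmetric algebra, whose endomorphism
   ring carries the form sum_j psi(h_j(f(g_j))), for a dual basis (g_j, h_j) of
   P and a symmetrizing form psi. *)

(** * Frobenius forms *)

Section FrobeniusForms.
Variables (R : comPzRingType) (A : algebraOver R).

(** The two halves say that u |-> phi(- u) is a bijection from A onto its dual. *)
Definition frobenius (phi : dual A) : Prop :=
  (forall x, (forall y, phi (y * x) = 0) -> x = 0) /\
  (forall f : dual A, exists u, forall y, f y = phi (y * u)).

Definition tracial (phi : dual A) : Prop :=
  forall x y, phi (x * y) = phi (y * x).

Lemma is_formP (f : A -> R) :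
  zmod_morphism f -> (forall c x, f (scal c * x) = c * f x) -> f \in is_form (A := A).
Proof. by move=> fB fZ; apply/asboolP. Qed.

Lemma dual0 (f : dual A) : f 0 = 0.
Proof. by rewrite -(subrr 0) dualB subrr. Qed.

Lemma dual_sum (f : dual A) (T : Type) (r : seq T) (P : pred T) (F : T -> A) :
  f (\sum_(i <- r | P i) F i) = \sum_(i <- r | P i) f (F i).
Proof. by apply: (big_morph f (dualD f)); exact: dual0. Qed.

Lemma nondegenerate_inj (phi : dual A) x x' : frobenius phi ->
  (forall y, phi (y * x) = phi (y * x')) -> x = x'.
Proof.
case=> inj _ e; apply/eqP; rewrite -subr_eq0; apply/eqP; apply: inj => y.
by rewrite mulrBr dualB e subrr.
Qed.

(** The map sending f to the unique u with f = phi(- u) is left linear for every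
   Frobenius form; the twisted trace identity makes it right linear. *)
Lemma dual_twisted_iso (phi : dual A) (s : {rmorphism A -> A}) :
  frobenius phi -> (forall x y, phi (x * y) = phi (y * s x)) ->
  bimod_isomorphic (dual_bimod A) (twisted_bimod s).
Proof.
move=> nd tw; have [inj surj] := nd.
have [g gE] := choice surj.
have gP (f : dual A) u : (forall y, f y = phi (y * u)) -> g f = u.
  by move=> fu; apply: (nondegenerate_inj nd) => y; rewrite -gE fu.
exists (g : dual_bimod A -> twisted_bimod s); split.
- exists (fun u => dual_lact u phi).
    by move=> f; apply: dual_ext => y /=; rewrite -gE.
  by move=> u; apply: gP.
- move=> f f'; apply: gP => y; rewrite mulrDr dualD.
  by rewrite -!gE.
- by move=> a f; apply: gP => y; rewrite /= gE mulrA.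
- by move=> f a; apply: gP => y; rewrite /= gE -mulrA tw mulrA.
Qed.

Lemma bimod_isomorphic_sym (M N : bimodule A) :
  bimod_isomorphic M N -> bimod_isomorphic N M.
Proof.
case=> f [[g fK gK] fD fl fr]; exists g; split.
- by exists f.
- by move=> x y; rewrite -{1}(gK x) -{1}(gK y) -fD fK.
- by move=> a x; rewrite -{1}(gK x) -fl fK.
- by move=> x a; rewrite -{1}(gK x) -fr fK.
Qed.

(** A bimodule isomorphism is determined by the image of 1, which is the form. *)
Lemma symmetric_algebraP : symmetric_algebra A <->
  exists2 phi : dual A, frobenius phi & tracial phi.
Proof.
split=> [[F [[G FK GK] FD Fl Fr]]|[phi nd sy]]; last first.
  by apply: bimod_isomorphic_sym; apply: (dual_twisted_iso nd).
pose phi : dual A := F 1.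
have FE x y : F x y = phi (y * x).
  have /(congr1 (fun f : dual A => f y)) := Fl x 1.
  by rewrite /= mulr1.
have F0 : F 0 = 0.
  by apply: (@addrI (dual A) (F 0)); rewrite -FD !addr0.
exists phi; first split.
- move=> x h; rewrite -(FK x) -[RHS](FK 0); congr G; rewrite F0.
  by apply: dual_ext => y; rewrite FE.
- by move=> f; exists (G f) => y; rewrite -FE GK.
move=> x y; rewrite -FE.
have /(congr1 (fun f : dual A => f x)) := Fr 1 y.
by rewrite /= mul1r.
Qed.

(** Nondegeneracy can be checked on a multiple: since psi is a trace form, a zero
   of psi(- x) is also a zero of psi(- x w), so the radical does not grow, and
   the forms phi(- u) are among the forms psi(- v). *)
Lemma frobenius_of_tracial_multiple (phi psi : dual A) w :
  frobenius phi -> tracial psi -> (forall x, phi x = psi (x * w)) ->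
  frobenius psi.
Proof.
move=> [inj surj] sy e; split=> [x h|f].
  by apply: inj => y; rewrite e sy mulrA h.
by have [u fu] := surj f; exists (u * w) => y; rewrite fu e mulrA.
Qed.

End FrobeniusForms.

Lemma symmetric_algebra_iso (R : comPzRingType) (A B : algebraOver R) :
  alg_isomorphic A B -> symmetric_algebra B -> symmetric_algebra A.
Proof.
case=> f [fB [f1 fM] fZ] [g fK gK] /symmetric_algebraP [psi [inj surj] sy].
apply/symmetric_algebraP.
have phiP : (fun x => psi (f x)) \in is_form (A := A).
  apply: is_formP => [x y|c x]; first by rewrite fB dualB.
  by rewrite fM fZ dualZ.
exists (Dual phiP); last by move=> x y /=; rewrite !fM sy.
have gM x y : g (x * y) = g x * g y by rewrite -(gK x) -(gK y) -fM !fK.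
have f0 : f 0 = 0 by have := fB 0 0; rewrite !subrr.
split=> [x h|l].
  rewrite -(fK x) [f x]inj ?fM; last by move=> y; rewrite -{1}(gK y) -fM; apply: h.
  by rewrite -f0 fK.
have lP : (fun y => l (g y)) \in is_form (A := B).
  apply: is_formP => [x y|c x].
    by rewrite -dualB; congr (l _); rewrite -{1}(gK x) -{1}(gK y) -fB fK.
  by rewrite gM -dualZ -[g (scal c)](congr1 g (fZ c)) fK.
have [u uE] := surj (Dual lP); exists (g u) => y.
by rewrite /= fM gK -uE /= fK.
Qed.

Lemma linear_bundle (A : pzRingType) (U V : lmodType A) (f : U -> V) :
  (forall a x y, f (a *: x + y) = a *: f x + f y) ->
  exists F : {linear U -> V}, F =1 f.
Proof.
move=> fL; pose m := GRing.isLinear.Build A U V *:%R f fL.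
by pose F : {linear U -> V} := HB.pack f m; exists F.
Qed.

Lemma linear_inverse (A : pzRingType) (U V : lmodType A) (f : {linear U -> V}) :
  bijective f -> exists g : {linear V -> U}, cancel f g /\ cancel g f.
Proof.
case=> g fK gK; have [a x y|G GE] := @linear_bundle A V U g.
  by rewrite -{1}(gK x) -{1}(gK y) -linearP fK.
by exists G; split=> x; rewrite GE.
Qed.

(** * Endomorphisms of projective modules *)

Definition dual_basis (C : pzRingType) (P : lmodType C) n
    (g : 'I_n -> P) (h : 'I_n -> {linear P -> C^o}) : Prop :=
  forall x, x = \sum_j (h j x : C) *: g j.

Section HattoriTrace.
Variables (k : comPzRingType) (C : algebraOver k) (psi : dual C).
Hypotheses (nd : frobenius psi) (sy : tracial psi).
Variables (P : lmodType C) (n : nat).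
Variables (g : 'I_n -> P) (h : 'I_n -> {linear P -> C^o}).
Hypothesis gh : dual_basis g h.

(** The composite of the trace End(P) -> C/[C,C] with the trace form psi. *)
Definition hattori_trace (f : P -> P) : k := \sum_j psi (h j (f (g j))).

(** The trace of x |-> l(x) q is l(q), up to commutators that psi ignores. *)
Lemma hattori_trace_rank_one (l : {linear P -> C^o}) q :
  hattori_trace (fun x => (l x : C) *: q) = psi (l q).
Proof.
rewrite {2}(gh q) linear_sum dual_sum; apply: eq_bigr => j _.
by rewrite !linearZ /= sy.
Qed.

Variables (B : algebraOver k) (E : B -> {linear P -> P}).
Hypotheses (EB : forall x y p, E (x - y) p = E x p - E y p)
  (EZ : forall c x p, E (scal c * x) p = (scal c : C) *: E x p)
  (EM : forall x y p, E (x * y) p = E y (E x p))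
  (E_inj : forall x, (forall p, E x p = 0) -> x = 0)
  (E_surj : forall f : {linear P -> P}, exists x, E x =1 f).

(** B is the opposite of End(P), as right multiplications are for a regular module.
   The maps x |-> h_j(x) c p span End(P), and by the rank one formula the trace of
   such a map followed by f is psi(c h_j(f(p))).  Hence a form lambda on B is
   represented by the map f whose coordinates h_j(f(p)) represent, with respect to
   psi, the forms that lambda induces on C through c |-> h_j(-) c p. *)
Lemma opposite_endomorphisms_symmetric : symmetric_algebra B.
Proof.
have EI x y : E x =1 E y -> x = y.
  move=> e; apply/eqP; rewrite -subr_eq0; apply/eqP; apply: E_inj => p.
  by rewrite EB e subrr.
have E0 p : E 0 p = 0 by rewrite -(subrr 0) EB subrr.
have ED x y p : E (x + y) p = E x p + E y p.
  by rewrite -{1}[y]opprK -(sub0r y) EB EB E0 sub0r opprK.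
have tauP : (fun x => hattori_trace (E x)) \in is_form (A := B).
  apply: is_formP => [x y|c x].
    rewrite /hattori_trace -sumrB; apply: eq_bigr => j _.
    by rewrite EB linearB dualB.
  rewrite /hattori_trace mulr_sumr; apply: eq_bigr => j _.
  by rewrite EZ linearZ dualZ.
apply/symmetric_algebraP; exists (Dual tauP); last first.
  move=> x y /=; rewrite /hattori_trace.
  have e (u v : B) : \sum_j psi (h j (E (u * v) (g j))) =
      \sum_j \sum_l psi ((h l (E u (g j)) : C) * h j (E v (g l))).
    apply: eq_bigr => j _; rewrite EM {1}(gh (E u (g j))) !linear_sum dual_sum.
    by apply: eq_bigr => l _; rewrite !linearZ.
  rewrite !e exchange_big; apply: eq_bigr => j _; apply: eq_bigr => l _.
  by rewrite sy.
(* r j c p is the element of B that acts as x |-> h_j(x) c p. *)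
have [r rE] : exists r : 'I_n -> C -> P -> B,
    forall j c p x, E (r j c p) x = ((h j x : C) * c) *: p.
  have ex j c p : exists b, forall x, E b x = ((h j x : C) * c) *: p.
    have [a x y|F FE] := @linear_bundle _ _ _ (fun x : P => ((h j x : C) * c) *: p).
      by rewrite linearP mulrDl scalerDl scalerA mulrA.
    by have [b bE] := E_surj F; exists b => x; rewrite bE FE.
  have /choice[r rE] : forall t : 'I_n * C * P,
      exists b, forall x, E b x = ((h t.1.1 x : C) * t.1.2) *: t.2.
    by move=> [[j c] p]; exact: ex.
  by exists (fun j c p => r (j, c, p)) => j c p x; rewrite rE.
have tau_r j c p x : hattori_trace (E (r j c p * x)) = psi (c * h j (E x p)).
  have [a u v|l lE] := @linear_bundle _ _ _ (fun x : P => ((h j x : C) * c : C^o)).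
    by rewrite linearP mulrDl -mulrA.
  transitivity (hattori_trace (fun x' => (l x' : C) *: E x p)).
    by apply: eq_bigr => i _; rewrite EM rE linearZ lE.
  by rewrite hattori_trace_rank_one lE sy.
split=> [x x0|f].
  apply: E_inj => p; rewrite (gh (E x p)) big1 // => j _.
  have [inj _] := nd; rewrite [h j _]inj ?scale0r // => c.
  by rewrite -tau_r; apply: x0.
have [u uE] : exists u : 'I_n -> P -> C,
    forall j p c, f (r j c p) = psi (c * u j p).
  have ex (t : 'I_n * P) : exists u, forall c, f (r t.1 c t.2) = psi (c * u).
    have fP : (fun c => f (r t.1 c t.2)) \in is_form (A := C).
      apply: is_formP => [c c'|c c'].
        rewrite -dualB; congr (f _); apply: EI => x.
        by rewrite EB !rE mulrBr scalerBl.
      rewrite -dualZ; congr (f _); apply: EI => x.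
      by rewrite EZ !rE scalerA mulrA -scal_central -mulrA.
    by have [u uE] := nd.2 (Dual fP); exists u => c; rewrite -uE.
  have [u uE] := choice ex; exists (fun j p => u (j, p)) => j p c.
  exact: (uE (j, p)).
have uL j a p q : u j (a *: p + q) = a * u j p + u j q.
  apply: (nondegenerate_inj nd) => c; rewrite -uE mulrDr mulrA dualD -!uE -dualD.
  by congr (f _); apply: EI => x; rewrite ED !rE scalerDr scalerA mulrA.
have [a p q|G GE] := @linear_bundle _ _ _ (fun p : P => \sum_j u j p *: g j).
  rewrite scaler_sumr -big_split; apply: eq_bigr => j _ /=.
  by rewrite uL scalerDl scalerA.
have [x xE] := E_surj G; exists x => y.
have -> : y = \sum_l r l 1 (E y (g l)).
  apply: EI => q; rewrite {1}(gh q) linear_sum.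
  have -> : E (\sum_l r l 1 (E y (g l))) q = \sum_l E (r l 1 (E y (g l))) q.
    by apply: (big_morph (fun b => E b q)) => // b c; rewrite ED.
  by apply: eq_bigr => l _; rewrite rE mulr1 linearZ.
rewrite mulr_suml !dual_sum; apply: eq_bigr => l _ /=.
rewrite tau_r mul1r xE GE; move: (E y (g l)) => q.
rewrite linear_sum dual_sum.
transitivity (\sum_j f (r j (h l (g j)) q)).
  rewrite -dual_sum; congr (f _); apply: EI => x'.
  have -> : E (\sum_j r j (h l (g j)) q) x' = \sum_j E (r j (h l (g j)) q) x'.
    by apply: (big_morph (fun b => E b x')) => // b c; rewrite ED.
  rewrite rE mulr1 {1}(gh x') linear_sum scaler_suml; apply: eq_bigr => j _.
  by rewrite linearZ rE.
by apply: eq_bigr => j _; rewrite uE linearZ sy.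
Qed.

End HattoriTrace.

(** * Morita invariance of symmetry *)

Section FreeModules.
Variable A : pzRingType.

Fact regular_fg : exists n (g : 'I_n -> (A^o : lmodType A)), forall x,
  exists c : 'I_n -> A, x = \sum_i c i *: g i.
Proof.
exists 1%N, (fun=> 1) => x; exists (fun=> x).
by rewrite big_ord1 /GRing.scale /= mulr1.
Qed.
Definition regular_fgmod : fgmod A := FgMod regular_fg.

Definition free_basis n (i : 'I_n) : {ffun 'I_n -> A^o} :=
  [ffun j => (i == j)%:R].

Lemma free_expand n (x : {ffun 'I_n -> A^o}) :
  x = \sum_i (x i : A) *: free_basis i.
Proof.
apply/ffunP => j; rewrite sum_ffunE (bigD1 j) //= !ffunE eqxx.
rewrite big1 => [|i ij]; last by rewrite !ffunE (negPf ij) /= [_ *: _]mulr0.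
by rewrite addr0 [_ *: _]mulr1.
Qed.

Fact free_fg n : exists m (g : 'I_m -> ({ffun 'I_n -> A^o} : lmodType A)),
  forall x, exists c : 'I_m -> A, x = \sum_i c i *: g i.
Proof.
exists n, (@free_basis n) => x; exists (fun i => x i); exact: free_expand.
Qed.
Definition free_fgmod n : fgmod A := FgMod (free_fg n).

Lemma free_cover (M : fgmod A) :
  exists n (p : {linear free_fgmod n -> M}), forall y, exists x, p x = y.
Proof.
have [n [g gE]] := fgmod_gen M; exists n.
have [a x y|p pE] := @linear_bundle A (free_fgmod n) M
    (fun x => \sum_i (x i : A) *: g i).
  rewrite scaler_sumr -big_split; apply: eq_bigr => i _ /=.
  by rewrite !ffunE scalerDl scalerA.
exists p => y; have [c ->] := gE y; exists [ffun i => c i].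
by rewrite pE; apply: eq_bigr => i _; rewrite ffunE.
Qed.

Lemma summand_dual_basis (M : fgmod A) n (p : {linear free_fgmod n -> M})
    (s : {linear M -> free_fgmod n}) : cancel s p ->
  exists (g : 'I_n -> M) (h : 'I_n -> {linear M -> A^o}), dual_basis g h.
Proof.
move=> sp; exists (fun i => p (free_basis i)).
have /choice[h hE] : forall i, exists h : {linear M -> A^o}, forall x,
    h x = (s x : {ffun 'I_n -> A^o}) i.
  move=> i; have [a x y|h hE] := @linear_bundle A M A^o
      (fun x => (s x : {ffun 'I_n -> A^o}) i); last by exists h.
  by rewrite linearP !ffunE.
exists h => x; rewrite -{1}(sp x) {1}(free_expand (s x)) linear_sum.
by apply: eq_bigr => i _; rewrite linearZ hE.
Qed.

End FreeModules.

(** The cokernel of a map into the regular module is what detects that an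
   epimorphism of finitely generated modules is surjective. *)
Section Cokernel.
Local Open Scope quotient_scope.
Variables (A : pzRingType) (M : lmodType A) (f : {linear M -> A^o}).

Definition image_pred : {pred A^o} := fun y => `[< exists x, f x = y >].
Fact image_pred_zmod : zmod_closed image_pred.
Proof.
split; first by apply/asboolP; exists 0; rewrite linear0.
move=> _ _ /asboolP[x <-] /asboolP[y <-]; apply/asboolP.
by exists (x - y); rewrite linearB.
Qed.
HB.instance Definition _ :=
  GRing.isZmodClosed.Build (A^o) image_pred image_pred_zmod.

Definition coker : Type := Quotient.quot image_pred.
HB.instance Definition _ := GRing.Zmodule.on coker.
HB.instance Definition _ := EqQuotient.on coker.

Definition coker_proj (x : A^o) : coker := \pi_coker x.

Lemma coker_projP x y : coker_proj x = coker_proj y <-> exists u, f u = x - y.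
Proof.
split=> [/eqP|h]; first by rewrite /coker_proj -Quotient.idealrBE => /asboolP.
by apply/eqP; rewrite /coker_proj -Quotient.idealrBE; apply/asboolP.
Qed.

Fact coker_proj_zmod : zmod_morphism coker_proj.
Proof. by move=> x y; rewrite /coker_proj !piE. Qed.
HB.instance Definition _ :=
  GRing.isZmodMorphism.Build (A^o) coker coker_proj coker_proj_zmod.

Definition coker_scale (a : A) (u : coker) : coker := coker_proj (a *: repr u).

Lemma coker_scaleE a x : coker_scale a (coker_proj x) = coker_proj (a *: x).
Proof.
apply/coker_projP; have [|u uE] := (coker_projP (repr (coker_proj x)) x).1.
  exact: reprK.
by exists (a *: u); rewrite linearZ uE [LHS]mulrBr.
Qed.

Lemma coker_ind (P : coker -> Prop) : (forall x, P (coker_proj x)) -> forall u, P u.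
Proof. by move=> h u; rewrite -(reprK u); exact: h. Qed.

Fact coker_scaleA a b u : coker_scale a (coker_scale b u) = coker_scale (a * b) u.
Proof. by elim/coker_ind: u => x; rewrite !coker_scaleE scalerA. Qed.
Fact coker_scale1 : left_id 1 coker_scale.
Proof. by elim/coker_ind => x; rewrite coker_scaleE scale1r. Qed.
Fact coker_scaleDr : right_distributive coker_scale +%R.
Proof.
move=> a; elim/coker_ind=> x; elim/coker_ind=> y.
by rewrite -raddfD !coker_scaleE -raddfD scalerDr.
Qed.
Fact coker_scaleDl u : {morph coker_scale^~ u : a b / a + b}.
Proof.
by elim/coker_ind: u => x a b; rewrite !coker_scaleE -raddfD scalerDl.
Qed.
HB.instance Definition _ := GRing.Zmodule_isLmodule.Build A coker
  coker_scaleA coker_scale1 coker_scaleDr coker_scaleDl.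

Lemma coker_projZ a x : coker_proj (a *: x) = a *: coker_proj x.
Proof. by rewrite -coker_scaleE. Qed.

Fact coker_fg : exists n (g : 'I_n -> (coker : lmodType A)), forall x,
  exists c : 'I_n -> A, x = \sum_i c i *: g i.
Proof.
exists 1%N, (fun=> coker_proj 1); elim/coker_ind => x; exists (fun=> x).
by rewrite big_ord1 -coker_projZ; congr coker_proj; rewrite [RHS]mulr1.
Qed.
Definition coker_fgmod : fgmod A := FgMod coker_fg.

End Cokernel.

(** Otherwise the projection to the cokernel and the zero map would be distinct
   maps that agree on the image of f. *)
Lemma epi_regular_hits_1 (A : pzRingType) (M : lmodType A)
    (f : {linear M -> regular_fgmod A}) :
  (forall (N : fgmod A) (u v : {linear regular_fgmod A -> N}),
     u \o f =1 v \o f -> u =1 v) ->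
  exists x, f x = (1 : A).
Proof.
move=> epi; pose N := coker_fgmod (f : {linear M -> A^o}).
have [a x y|u uE] := @linear_bundle A (regular_fgmod A) N
    (coker_proj (f : {linear M -> A^o})).
  by rewrite raddfD /= coker_projZ.
have [a x y|v vE] := @linear_bundle A (regular_fgmod A) N (fun=> 0).
  by rewrite scaler0 addr0.
have /(_ (1 : A)) : u =1 v.
  apply: epi => x /=; rewrite uE vE -(raddf0 (coker_proj (f : {linear M -> A^o}))).
  by apply/coker_projP; exists x; rewrite subr0.
rewrite uE vE -(raddf0 (coker_proj (f : {linear M -> A^o}))) => /coker_projP[x fx].
by exists x; rewrite [LHS]fx subr0.
Qed.

Section Equivalence.
Variables (k : comPzRingType) (A B : algebraOver k).
Variables (F : mod_functor A B) (G : mod_functor B A).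
Hypotheses (FG : left_quasi_inverse F G) (GF : left_quasi_inverse G F).

Lemma fmap_ext (A' B' : algebraOver k) (H : mod_functor A' B') (M N : fgmod A')
  (f g : {linear M -> N}) : f =1 g -> fmap H f =1 fmap H g.
Proof.
move=> fg; have e : f =1 g \o idfun by [].
have i : fmap H (idfun : {linear M -> M}) =1 id by apply: fmap_id.
by move=> x; by rewrite (fmap_comp (m := H) e) /= i.
Qed.

Lemma quasi_inverse_faithful (A' B' : algebraOver k) (H : mod_functor A' B')
    (H' : mod_functor B' A') (M N : fgmod A') (f g : {linear M -> N}) :
  left_quasi_inverse H H' -> fmap H f =1 fmap H g -> f =1 g.
Proof.
case=> eta [eta_bij eta_nat] fg x; apply: (bij_inj (eta_bij N)).
have := eta_nat _ _ f x; rewrite /= => ->.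
have := eta_nat _ _ g x; rewrite /= => ->.
exact: fmap_ext.
Qed.

(** A preimage of h is obtained by conjugating G h with the unit; that its image
   is h follows from faithfulness of G. *)
Lemma equivalence_full (M N : fgmod A) (h : {linear F M -> F N}) :
  exists f : {linear M -> N}, fmap F f =1 h.
Proof.
have [eta [eta_bij eta_nat]] := FG.
have [g [gK Kg]] := linear_inverse (eta_bij N).
pose f : {linear M -> N} := g \o fmap G h \o eta M.
exists f; apply: (quasi_inverse_faithful GF) => x.
have [y ->] : exists y, x = eta M y.
  by have [e _ eK] := eta_bij M; exists (e x); rewrite eK.
by have := eta_nat _ _ f y; rewrite /= Kg.
Qed.

(** F(A) is a direct summand of a free module.  Let p be a surjection from a free
   module onto F(A).  Then G(p), followed by the inverse of the unit, is an
   epimorphism onto the regular module A, hence hits 1 and splits; applying F and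
   the unit of the other composite turns the splitting into one of p. *)
Lemma equivalence_projective :
  exists n (g : 'I_n -> F (regular_fgmod A))
    (h : 'I_n -> {linear F (regular_fgmod A) -> B^o}), dual_basis g h.
Proof.
set P := F (regular_fgmod A).
have [n [p p_surj]] := free_cover P; exists n.
have [eta [eta_bij eta_nat]] := FG; have [eta' [eta'_bij eta'_nat]] := GF.
have [e [eK Ke]] := linear_inverse (eta_bij (regular_fgmod A)).
have [e'P [e'PK Ke'P]] := linear_inverse (eta'_bij P).
have [e'L [e'LK Ke'L]] := linear_inverse (eta'_bij (free_fgmod B n)).
pose f : {linear G (free_fgmod B n) -> regular_fgmod A} := e \o fmap G p.
have [|x fx] := @epi_regular_hits_1 A _ f.
  move=> N u v uv; apply: (quasi_inverse_faithful FG) => y.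
  (* Up to the units, F(f) is p, so every y comes from the free module. *)
  have [z ->] : exists z, y = fmap F f (eta' (free_fgmod B n) z).
    have Ff : fmap F f =1 fmap F e \o fmap F (fmap G p) by apply: fmap_comp.
    have ee : idfun =1 e \o eta (regular_fgmod A) by move=> t /=; rewrite eK.
    have [z0 z0E] := p_surj (e'P (fmap F (eta (regular_fgmod A)) y)).
    exists z0; rewrite Ff /=.
    have := eta'_nat _ _ p z0; rewrite /= => <-; rewrite z0E Ke'P.
    have := fmap_comp (m := F) ee y; rewrite /= => <-.
    by rewrite fmap_id.
  have uvf : (u \o f : {linear _ -> N}) =1 v \o f by [].
  have uf := fmap_comp (m := F) (frefl (u \o f : {linear _ -> N})).
  by have /= <- := uf (eta' (free_fgmod B n) z); rewrite (fmap_comp (m := F) uvf).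
have [a y z|s sE] := @linear_bundle A (regular_fgmod A) (G (free_fgmod B n))
    (fun y => (y : A) *: x).
  by rewrite scalerDl scalerA.
have ps : eta (regular_fgmod A) =1 fmap G p \o s.
  move=> y /=; rewrite sE linearZ -(Ke (fmap G p x)).
  by rewrite -linearZ; congr (eta _ _); rewrite -/f /= [e _]fx [_ *: _]mulr1.
(* F(s) splits p only up to this automorphism, the composite of the two units. *)
have [b [bK Kb]] : exists b : {linear P -> P},
    cancel b (e'P \o fmap F (eta (regular_fgmod A))) /\
    cancel (e'P \o fmap F (eta (regular_fgmod A))) b.
  pose b : {linear P -> P} := fmap F e \o eta' P.
  exists b; split=> y /=.
    have ee : idfun =1 eta (regular_fgmod A) \o e by move=> t /=; rewrite Ke.
    by have := fmap_comp (m := F) ee (eta' P y); rewrite /= fmap_id // => <-; rewrite e'PK.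
  have ee : idfun =1 e \o eta (regular_fgmod A) by move=> t /=; rewrite eK.
  by rewrite Ke'P; have := fmap_comp (m := F) ee y; rewrite /= fmap_id.
pose t : {linear P -> free_fgmod B n} := e'L \o fmap F s \o b.
apply: (@summand_dual_basis _ P n p t) => y /=.
apply: (bij_inj (eta'_bij P)).
have := eta'_nat _ _ p (e'L (fmap F s (b y))); rewrite /= => ->.
rewrite Ke'L; have := fmap_comp (m := F) ps (b y); rewrite /= => <-.
by rewrite -[RHS](congr1 (eta' P) (bK y)) /= Ke'P.
Qed.

End Equivalence.

(** The regular module has the opposite of B as endomorphism ring, and an
   equivalence carries it to a projective module with the same endomorphisms. *)
Lemma morita_symmetric (k : comPzRingType) (B C : algebraOver k) :
  morita_equivalent B C -> symmetric_algebra C -> symmetric_algebra B.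
Proof.
case=> F [G [FG GF]] /symmetric_algebraP[psi nd sy].
have [n [g [h gh]]] := equivalence_projective FG GF.
have /choice[rho rhoE] : forall b : B,
    exists r : {linear regular_fgmod B -> regular_fgmod B},
    forall x : B, r x = x * b :> B.
  move=> b; have [a x y|r rE] := @linear_bundle B (regular_fgmod B)
      (regular_fgmod B) (fun x => (x : B) * b); last by exists r.
  by rewrite [LHS]mulrDl -mulrA.
have rhoP c x y p : fmap F (rho (scal c * x + y)) p =
    (scal c : C) *: fmap F (rho x) p + fmap F (rho y) p.
  apply: fmap_linear => u; rewrite !rhoE [LHS]mulrDr; congr (_ + _).
  by rewrite mulrA -scal_central -mulrA.
have scalN1 (A : algebraOver k) : scal (-1) = -1 :> A.
  by rewrite raddfN; congr (- _); exact: scal_monoid.1.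
have rho0 p : fmap F (rho 0) p = 0.
  by have := rhoP (-1) 0 0 p; rewrite mulr0 addr0 scalN1 scaleN1r addNr.
apply: (opposite_endomorphisms_symmetric nd sy gh (E := fun b => fmap F (rho b))).
- move=> x y p; have := rhoP (-1) y x p.
  by rewrite !scalN1 mulN1r scaleN1r !(addrC (- _)).
- move=> c x p; have := rhoP c x 0 p; rewrite addr0 => ->.
  by rewrite rho0 addr0.
- by move=> x y p; apply: fmap_comp => u /=; rewrite !rhoE mulrA.
- move=> x x0; have /(_ (1 : B)) : rho x =1 rho 0.
    by apply: (quasi_inverse_faithful FG) => p; rewrite x0 rho0.
  by rewrite !rhoE !mul1r.
- move=> f; have [r rf] := equivalence_full FG GF f.
  exists (r (1 : B)) => p; rewrite -rf; apply: fmap_ext => u.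
  have e : (u : B) *: ((1 : B) : regular_fgmod B) = u by exact: mulr1.
  by rewrite rhoE -{2}e linearZ.
Qed.

(** * Algebras with path coordinates *)

Section GentlePaths.
Variables (k : fieldType) (Q : quiver) (I : set (pathalg k Q)).
Hypothesis gentleI : complete_gentle I.
Local Notation sg := (sigma I).
Local Notation sgi j a := (iter j (sigma I) a).

Lemma arrow_at : exists d : vertex Q -> arrow Q, forall i, source (d i) = i.
Proof.
have [card2 _ _] := gentleI.
have [|d dP] := @choice _ _ (fun i (a : arrow Q) => source a = i); last by exists d.
move=> i; have [+ _] := card2 i; case: (pickP [pred a : arrow Q | source a == i]) => [a /eqP ai _|h].
  by exists a.
by rewrite (eq_card0 h).
Qed.

(** Here pe a l stands for the path P_a^l, with P_a^0 the idempotent at the source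
   of a, and cf x a l for the coefficient of P_a^l in x.  An idempotent is thus
   indexed by both arrows that start at its vertex.  This describes the path
   algebra, its quotient by I and the completed algebra at once. *)
Record path_coordinates (L : algebraOver k) (cf : L -> arrow Q -> nat -> k)
    (pe : arrow Q -> nat -> L) : Prop := PathCoordinates {
  cfB : forall x y a l, cf (x - y) a l = cf x a l - cf y a l;
  cfZ : forall c x a l, cf (scal c * x) a l = c * cf x a l;
  cfM : forall x y a l,
    cf (x * y) a l = \sum_(j < l.+1) cf x (sgi j a) (l - j)%N * cf y a j;
  cf_source : forall x a b, source a = source b -> cf x a 0 = cf x b 0;
  cf_pe : forall b j a l, cf (pe b j) a l =
    ((l == j) && (if j == 0 then source a == source b else a == b))%:R
}.

Section Coordinates.
Variables (L : algebraOver k) (cf : L -> arrow Q -> nat -> k).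
Variables (pe : arrow Q -> nat -> L) (coordP : path_coordinates cf pe).
Variables (N : arrow Q -> nat) (w : arrow Q -> k).
Hypotheses (N_gt0 : forall a, (0 < N a)%N) (N_sigma : forall a, N (sg a) = N a)
  (sigma_N : forall a, sgi (N a) a = a) (w_neq0 : forall a, w a != 0).

Local Notation cfB := (cfB coordP).
Local Notation cfZ := (cfZ coordP).
Local Notation cfM := (cfM coordP).
Local Notation cf_pe := (cf_pe coordP).

Lemma cf0 a l : cf 0 a l = 0.
Proof. by rewrite -(subrr 0) cfB subrr. Qed.

Lemma cfD x y a l : cf (x + y) a l = cf x a l + cf y a l.
Proof. by rewrite -{1}[y]opprK -(sub0r y) !cfB cf0 sub0r opprK. Qed.

Lemma cf_sum (T : Type) (r : seq T) (P : pred T) (F : T -> L) a l :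
  cf (\sum_(i <- r | P i) F i) a l = \sum_(i <- r | P i) cf (F i) a l.
Proof. by apply: (big_morph (fun x => cf x a l)) => [x y|]; rewrite (cfD, cf0). Qed.

Lemma N_iter j a : N (sgi j a) = N a.
Proof. by elim: j => //= j IHj; rewrite N_sigma. Qed.

(** The coefficients at the paths P_a^N(a), which span the socle of the quotient,
   weighted by w.  Opposite weights at each vertex give the form on the twisted
   Brauer graph algebra, and equal weights the one on the Brauer graph algebra. *)
Definition socle_form (x : L) : k := \sum_a w a * cf x a (N a).

(** The radical of the bilinear form (x, y) |-> socle_form (x y). *)
Definition form_kernel (x : L) : Prop :=
  (forall a l, (l < N a)%N -> cf x a l = 0) /\
  (forall i, \sum_(a | source a == i) w a * cf x a (N a) = 0).

Lemma socle_formB x y : socle_form (x - y) = socle_form x - socle_form y.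
Proof. by rewrite -sumrB; apply: eq_bigr => a _; rewrite cfB mulrBr. Qed.

Lemma socle_formZ c x : socle_form (scal c * x) = c * socle_form x.
Proof. by rewrite mulr_sumr; apply: eq_bigr => a _; rewrite cfZ mulrCA. Qed.

Lemma socle_form_kernel x : form_kernel x -> socle_form x = 0.
Proof.
by case=> _ x0; rewrite /socle_form (partition_big (@source Q) predT) //= big1.
Qed.

Lemma form_kernel_ideal : is_ideal form_kernel.
Proof.
split.
- by split=> [a l _|i]; [rewrite cf0|rewrite big1 // => a _; rewrite cf0 mulr0].
- move=> x y [x0 xs] [y0 ys]; split=> [a l la|i]; first by rewrite cfB x0 ?y0 ?subrr.
  by under eq_bigr do rewrite cfB mulrBr; rewrite sumrB xs ys subrr.
move=> y x [x0 xs]; split; split=> [a l la|i].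
- rewrite cfM big1 // => j _; rewrite [cf x _ _]x0 ?mulr0 //.
  by apply: leq_ltn_trans la; exact: leq_ord.
- have [d dP] := arrow_at.
  rewrite (eq_bigr (fun a => cf y (d i) 0 * (w a * cf x a (N a)))) => [|a /eqP ai].
    by rewrite -mulr_sumr xs mulr0.
  rewrite cfM big_ord_recr /= big1 ?add0r => [|j _].
    rewrite subnn mulrCA; congr (_ * _); rewrite sigma_N.
    by apply: (cf_source coordP); rewrite ai dP.
  by rewrite [cf x _ _]x0 ?mulr0.
- rewrite cfM big1 // => j _; rewrite x0 ?mul0r // N_iter.
  by apply: leq_ltn_trans la; rewrite leq_subr.
- have [d dP] := arrow_at.
  rewrite (eq_bigr (fun a => cf y (d i) 0 * (w a * cf x a (N a)))) => [|a /eqP ai].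
    by rewrite -mulr_sumr xs mulr0.
  rewrite cfM big_ord_recl /= big1 ?addr0 => [|j _].
    rewrite subn0 mulrA mulrC; congr (_ * _).
    by apply: (cf_source coordP); rewrite ai dP.
  by rewrite x0 ?mul0r // N_sigma N_iter ltn_subrL N_gt0.
Qed.

(** Among the socle paths only the rotation of P_b^N(b) that starts at sigma^l(b)
   ends with the arrows of P_b^l, so P_b^l pairs with the complementary path. *)
Lemma socle_form_pe_mul b l y : (0 < l <= N b)%N ->
  socle_form (pe b l * y) = w (sgi l b) * cf y (sgi l b) (N b - l)%N.
Proof.
case/andP=> l0 lN; have lz : (l == 0)%N = false by rewrite eqn0Ngt l0.
rewrite /socle_form (bigD1 (sgi l b)) //= [X in _ + X]big1 ?addr0 => [|a ab].
  congr (_ * _); rewrite cfM N_iter.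
  have hj : (N b - l < (N b).+1)%N by rewrite ltnS leq_subr.
  rewrite (bigD1 (Ordinal hj)) //= cf_pe subKn // eqxx lz /=.
  rewrite -iterD subnK // sigma_N eqxx mul1r big1 ?addr0 // => j jn.
  rewrite cf_pe; case: eqP => [e|]; last by rewrite mul0r.
  case/eqP: jn; apply: val_inj => /=.
  by rewrite -e subKn //; exact: leq_ord.
rewrite cfM big1 ?mulr0 // => j _; rewrite cf_pe lz.
case: eqP => [e|]; last by rewrite mul0r.
case: eqP => [e'|]; last by rewrite mul0r.
case/eqP: ab; rewrite -e' -iterD -e subnK ?sigma_N //; exact: leq_ord.
Qed.

Lemma socle_form_mul_pe b l y : (0 < l <= N b)%N ->
  socle_form (y * pe b l) = w b * cf y (sgi l b) (N b - l)%N.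
Proof.
case/andP=> l0 lN; have lz : (l == 0)%N = false by rewrite eqn0Ngt l0.
rewrite /socle_form (bigD1 b) //= [X in _ + X]big1 ?addr0 => [|a ab].
  congr (_ * _); rewrite cfM (bigD1 (Ordinal (lN : l < (N b).+1)%N)) //=.
  rewrite cf_pe !eqxx lz mulr1 big1 ?addr0 // => j jn.
  rewrite cf_pe; case: eqP => [e|]; last by rewrite mulr0.
  by case/eqP: jn; apply: val_inj.
by rewrite cfM big1 ?mulr0 // => j _; rewrite cf_pe lz (negPf ab) andbF mulr0.
Qed.

Lemma socle_form_pe0_mul b y : socle_form (pe b 0 * y) =
  \sum_(a | source a == source b) w a * cf y a (N a).
Proof.
rewrite [RHS]big_mkcond /=; apply: eq_bigr => a _.
rewrite cfM big_ord_recr /= big1 ?add0r => [|j _].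
  by rewrite subnn sigma_N cf_pe eqxx /=; case: eqP => _; rewrite ?mul1r // mul0r mulr0.
by rewrite cf_pe subn_eq0 leqNgt ltn_ord mul0r.
Qed.

Lemma socle_form_mul_pe0 b y : socle_form (y * pe b 0) =
  \sum_(a | source a == source b) w a * cf y a (N a).
Proof.
rewrite [RHS]big_mkcond /=; apply: eq_bigr => a _.
rewrite cfM big_ord_recl /= big1 ?addr0 => [|j _].
  by rewrite subn0 cf_pe /=; case: eqP => _; rewrite ?mulr1 // !mulr0.
by rewrite cf_pe mulr0.
Qed.

(** Pairing x with the complement of P_a^l isolates the coefficient at P_a^l, and
   pairing it with an idempotent yields the socle condition at that vertex. *)
Lemma socle_form_radical x :
  (forall y, socle_form (y * x) = 0) -> form_kernel x.
Proof.
move=> x0; split=> [a l la|i].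
  have h : (0 < N a - l <= N (sgi l a))%N by rewrite N_iter subn_gt0 la leq_subr.
  have := x0 (pe (sgi l a) (N a - l)%N).
  rewrite socle_form_pe_mul // N_iter -iterD subnK ?sigma_N ?subKn ?(ltnW la) //.
  by move/eqP; rewrite mulf_eq0 (negPf (w_neq0 a)) => /eqP.
have [d dP] := arrow_at.
by have := x0 (pe (d i) 0); rewrite socle_form_pe0_mul dP.
Qed.

(** Only the coefficients up to length N are prescribed, so that finite sums are
   enough. *)
Lemma interpolation (c : arrow Q -> nat -> k) :
  (forall a b, source a = source b -> c a 0 = c b 0) ->
  exists d : vertex Q -> arrow Q, forall a l, (l <= N a)%N ->
  cf (\sum_i scal (c (d i) 0) * pe (d i) 0 +
      \sum_b \sum_(j < N b) scal (c b j.+1) * pe b j.+1) a l = c a l.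
Proof.
move=> cS; have [d dP] := arrow_at; exists d => a l lN.
rewrite cfD !cf_sum.
have -> : \sum_b cf (\sum_(j < N b) scal (c b j.+1) * pe b j.+1) a l =
          if l is l'.+1 then c a l else 0.
  rewrite (bigD1 a) //= [X in _ + X]big1 ?addr0 => [|b ba].
    rewrite cf_sum; under eq_bigr do rewrite cfZ cf_pe /= eqxx andbT.
    case: l lN => [|l] lN; first by rewrite big1 // => j _; rewrite mulr0.
    rewrite (bigD1 (Ordinal lN)) //= eqxx mulr1 big1 ?addr0 // => j jl.
    rewrite eqSS; case: eqP => [e|]; last by rewrite mulr0.
    by case/eqP: jl; apply: val_inj.
  rewrite cf_sum big1 // => j _.
  by rewrite cfZ cf_pe /= [a == b]eq_sym (negPf ba) andbF mulr0.
under eq_bigr do rewrite cfZ cf_pe dP.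
case: l lN => [|l] lN; last by rewrite big1 ?add0r // => i _; rewrite mulr0.
rewrite addr0 (bigD1 (source a)) //= eqxx mulr1 big1 ?addr0 => [|i ia].
  by apply: cS; rewrite dP.
by rewrite eq_sym (negPf ia) mulr0.
Qed.

Variables (S : set L) (SK : forall x, ideal_gen S x <-> form_kernel x).
Local Notation D := (quot S).

Lemma qproj_coordP x y : form_kernel (x - y) -> qproj x = qproj y :> D.
Proof. by move=> h; apply/qprojP/SK. Qed.

Lemma quot_path_ind (P : D -> Prop) : P 0 ->
  (forall u v, P u -> P v -> P (u + v)) ->
  (forall c u, P u -> P (scal c * u)) ->
  (forall a l, (l <= N a)%N -> P (qproj (pe a l))) -> forall u, P u.
Proof.
move=> P0 PD PZ Pp u; have [x ->] := qproj_surj u.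
have [d h] := interpolation (cf_source coordP x).
have -> : qproj x = qproj (\sum_i scal (cf x (d i) 0) * pe (d i) 0 +
      \sum_b \sum_(j < N b) scal (cf x b j.+1) * pe b j.+1) :> D.
  apply: qproj_coordP; split=> [a l la|i]; first by rewrite cfB h ?subrr // ltnW.
  by rewrite big1 // => a _; rewrite cfB h // subrr mulr0.
have PS T (F : T -> L) (r : seq T) : (forall i, P (qproj (F i))) ->
    P (qproj (\sum_(i <- r) F i)).
  move=> PF; rewrite raddf_sum; elim/big_rec: _ => // i v _ Pv.
  by apply: PD; first exact: PF.
have PZp c a l : (l <= N a)%N -> P (qproj (scal c * pe a l)).
  by move=> la; rewrite rmorphM; apply: PZ; apply: Pp.
rewrite raddfD; apply: PD; first by apply: (PS) => i; apply: PZp.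
by apply: (PS) => b; apply: PS => j; apply: PZp; exact: ltn_ord.
Qed.

Lemma socle_form_repr x : socle_form (repr (qproj x : D)) = socle_form x.
Proof.
apply/eqP; rewrite -subr_eq0 -socle_formB; apply/eqP/socle_form_kernel/SK/qprojP.
exact: qrepr.
Qed.

Fact quot_form_subproof :
  (fun u : D => socle_form (repr u)) \in is_form (A := D).
Proof.
apply: is_formP => [u v|c u].
  rewrite -{1}(qrepr u) -{1}(qrepr v) -raddfB socle_form_repr.
  exact: socle_formB.
by rewrite -{1}(qrepr u) -[scal c * _](rmorphM qproj) socle_form_repr socle_formZ.
Qed.
Definition quot_form : dual D := Dual quot_form_subproof.

Lemma quot_formE x : quot_form (qproj x) = socle_form x.
Proof. exact: socle_form_repr. Qed.

Lemma quot_formM x y : quot_form (qproj x * qproj y) = socle_form (x * y).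
Proof. by rewrite -[qproj x * _](rmorphM qproj) quot_formE. Qed.

(** For a form f, the equations phi(P_b^l u) = f(P_b^l) prescribe one coefficient
   of u each, since P_b^l pairs with its complement only.  The coefficient at an
   idempotent is prescribed by two arrows; the values agree because the two socle
   paths at a vertex are proportional in the quotient. *)
Lemma quot_form_frobenius : frobenius quot_form.
Proof.
split=> [u|f].
  have [x ->] := qproj_surj u => h.
  rewrite -(raddf0 (qproj : L -> D)); apply/qproj_coordP; rewrite subr0.
  by apply: socle_form_radical => y; rewrite -quot_formM.
pose F b l := f (qproj (pe b l)).
have Nz a : (N a == 0)%N = false by rewrite eqn0Ngt N_gt0.
have FN a b : source a = source b -> F a (N a) / w a = F b (N b) / w b.
  move=> ab; apply/eqP; rewrite eqr_div // mulrC [X in _ == X]mulrC -!dualZ.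
  rewrite -![scal _ * qproj _](rmorphM qproj); apply/eqP.
  congr (f _); apply: qproj_coordP; split=> [c l lc|i].
    rewrite cfB !cfZ !cf_pe !Nz.
    have e u : (l == N u) && (c == u) = false.
      by apply/negP => /andP[/eqP lu /eqP cu]; rewrite lu -cu ltnn in lc.
    by rewrite !e !mulr0 subrr.
  rewrite (eq_bigr (fun c => w c * (w b * (c == a)%:R) - w c * (w a * (c == b)%:R))).
    have e u v : \sum_(c | source c == i) w c * (w v * (c == u)%:R) =
        if source u == i then w u * w v else 0.
      rewrite big_mkcond (bigD1 u) //= big1 ?addr0 ?eqxx ?mulr1 // => c cu.
      by rewrite (negPf cu) !mulr0 if_same.
    by rewrite sumrB !e ab mulrC subrr.
  move=> c _; rewrite cfB !cfZ !cf_pe !Nz.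
  have e u : (N c == N u) && (c == u) = (c == u).
    by have [->|] := eqVneq c u; rewrite ?eqxx ?andbF.
  by rewrite !e mulrBr.
have [d dP] := arrow_at.
(* The socle coefficients at a vertex count only through their weighted sum, so
   they can be concentrated on the chosen arrow d i. *)
pose c a l := if (l < N a)%N then F (sgi l a) (N a - l)%N / w a
              else if a == d (source a) then F a 0 / w a else 0.
have [|d' uE] := @interpolation c.
  by move=> a b ab; rewrite /c !N_gt0 /= !subn0; apply: FN.
set u := (X in cf X) in uE; exists (qproj u).
elim/quot_path_ind => [|v v' h h'|e v h|b l lN].
- by rewrite mul0r !dual0.
- by rewrite mulrDl !dualD h h'.
- by rewrite -mulrA !dualZ h.
rewrite quot_formM; have [->|l0] := posnP l.
  rewrite socle_form_pe0_mul.
  have -> : qproj (pe b 0) = qproj (pe (d (source b)) 0) :> D.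
    apply: qproj_coordP; have e a l' : cf (pe b 0 - pe (d (source b)) 0) a l' = 0.
      by rewrite cfB !cf_pe /= dP subrr.
    by split=> // i; rewrite big1 // => a _; rewrite e mulr0.
  rewrite (bigD1 (d (source b))) ?dP //= big1 ?addr0 => [|a /andP[/eqP ab ad]].
    by rewrite uE // /c ltnn dP eqxx mulrC divfK.
  by rewrite uE // /c ltnn ab (negPf ad) mulr0.
rewrite socle_form_pe_mul ?l0 // uE ?N_iter ?leq_subr // /c N_iter.
rewrite ltn_subrL l0 N_gt0 /= -iterD subnK // sigma_N subKn //.
by rewrite mulrC divfK.
Qed.

(** Exchanging P_b^l with its complement replaces the weight of sigma^l(b) by the
   weight of b; the twist s makes up for their quotient r b l. *)
Lemma quot_form_twisted (s : {rmorphism D -> D}) (r : arrow Q -> nat -> k) :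
  (forall c, s (scal c) = scal c) ->
  (forall b l, (l <= N b)%N -> s (qproj (pe b l)) = scal (r b l) * qproj (pe b l)) ->
  (forall b l, (l <= N b)%N -> r b l * w b = w (sgi l b)) ->
  forall x y, quot_form (x * y) = quot_form (y * s x).
Proof.
move=> sc sp rw x y; elim/quot_path_ind: x => [|v v' h h'|e v h|b l lN].
- by rewrite mul0r rmorph0 mulr0.
- by rewrite mulrDl rmorphD mulrDr !dualD h h'.
- by rewrite -mulrA rmorphM sc dualZ h mulrA -scal_central -mulrA dualZ.
rewrite sp // mulrA -scal_central -mulrA dualZ.
have [z ->] := qproj_surj y; rewrite !quot_formM.
have [l0|l0] := posnP l.
  rewrite l0 socle_form_pe0_mul socle_form_mul_pe0.
  have /eqP := rw b 0 isT; rewrite -subr_eq0 /= -{2}(mul1r (w b)) -mulrBl.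
  by rewrite mulf_eq0 (negPf (w_neq0 b)) orbF subr_eq0 => /eqP ->; rewrite mul1r.
by rewrite socle_form_pe_mul ?l0 // socle_form_mul_pe ?l0 // mulrA rw.
Qed.

End Coordinates.
End GentlePaths.

(** * Paths that avoid the relations *)

Lemma ideal_sum (A : pzRingType) (J : set A) (T : Type) (r : seq T) (P : pred T)
    (F : T -> A) : is_ideal J -> (forall i, P i -> J (F i)) ->
  J (\sum_(i <- r | P i) F i).
Proof.
move=> idJ JF; elim/big_ind: _ => //; first by case: idJ.
by move=> x y; apply: is_idealD.
Qed.

Lemma ideal_mull (A : pzRingType) (J : set A) x y : is_ideal J -> J y -> J (x * y).
Proof. by case=> _ _ M /(M x)[]. Qed.

Lemma ideal_mulr (A : pzRingType) (J : set A) x y : is_ideal J -> J x -> J (x * y).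
Proof. by case=> _ _ M /(M y)[]. Qed.

Local Arguments coef : simpl never.
Local Arguments pelt : simpl never.

Section StringPaths.
Variables (k : fieldType) (Q : quiver) (I : set (pathalg k Q)).
Hypothesis gentleI : complete_gentle I.
Local Notation sg := (sigma I).
Local Notation sgi j a := (iter j (sigma I) a).

Lemma source_pair (a : arrow Q) : exists b, [/\ b != a, source b = source a,
  forall c, source c = source a -> c = a \/ c = b &
  forall (V : nmodType) (F : arrow Q -> V),
    \sum_(c | source c == source a) F c = F a + F b].
Proof.
have [card2 _ _] := gentleI; have [+ _] := card2 (source a).
rewrite (cardD1 a) inE eqxx add1n => -[/mem_card1[b bE]].
have := bE b; rewrite !inE eqxx => /andP[ba /eqP sb].
exists b; split=> // [c ca|V F].
  have [->|cna] := eqVneq c a; [by left|right].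
  by apply/eqP; have := bE c; rewrite !inE cna ca eqxx => /esym.
rewrite (bigD1 a) //=; congr (_ + _).
rewrite (eq_bigl (pred1 b)) ?big_pred1_eq // => c.
by have := bE c; rewrite !inE andbC.
Qed.

Fact spath_subproof a l : walk (source a) (traject sg a l).
Proof.
elim: l a => // l IHl a; rewrite /= eqxx /= -(source_sigma gentleI); exact: IHl.
Qed.
(** The path P_a^l. *)
Definition spath a l : qpath Q :=
  @QPath Q (source a, traject sg a l) (spath_subproof a l).

Lemma plen_spath a l : plen (spath a l) = l.
Proof. by rewrite /plen size_traject. Qed.

Lemma take_traject (T : Type) (f : T -> T) x i j :
  take i (traject f x (i + j)) = traject f x i.
Proof. by rewrite trajectD take_size_cat ?size_traject. Qed.

Lemma drop_traject (T : Type) (f : T -> T) x i j :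
  drop i (traject f x (i + j)) = traject f (iter i f x) j.
Proof. by rewrite trajectD drop_size_cat ?size_traject. Qed.

Lemma ptake_spath a i j : ptake i (spath a (i + j)) = spath a i.
Proof. by apply: val_inj; rewrite /= take_traject. Qed.

Lemma pend_spath a l : pend (spath a l) = source (sgi l a).
Proof.
rewrite /pend /=; case: l => [|l] //.
by rewrite trajectSr map_rcons last_rcons iterS source_sigma.
Qed.

Lemma pdrop_spath a i j : pdrop i (spath a (i + j)) = spath (sgi i a) j.
Proof. by apply: val_inj; rewrite /= ptake_spath pend_spath drop_traject. Qed.

Lemma spath0 a : spath a 0 = trivial_path (source a).
Proof. exact: val_inj. Qed.

Lemma spath1 a : spath a 1 = arrow_path a.
Proof. exact: val_inj. Qed.

Lemma spath_eq a l b j : (spath a l == spath b j) =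
  (l == j) && (if j == 0%N then source a == source b else a == b).
Proof.
apply/eqP/andP => [e|[/eqP -> h]].
  have lj : l = j by rewrite -(plen_spath a l) e plen_spath.
  split; first exact/eqP.
  have := congr1 (@path_data Q) e; rewrite lj; case: j {e lj} => [|j] /=.
    by case=> ->.
  by case=> _ ->.
by case: eqP h => [->|_] /eqP e; [rewrite !spath0 e|rewrite e].
Qed.

Lemma pelt_spathD a i j : pelt (spath a (i + j)) =
  pelt (spath (sgi i a) j) * pelt (spath a i) :> pathalg k Q.
Proof. by rewrite -(@pelt_cat _ _ i) ?plen_spath ?leq_addr // pdrop_spath ptake_spath. Qed.

Lemma pelt_spathS a l : pelt (spath a l.+1) = pelt (spath (sg a) l) * arr a
  :> pathalg k Q.
Proof. by rewrite -add1n pelt_spathD spath1. Qed.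

Lemma prod_traject a l : pelt (spath a l.+1) =
  \prod_(b <- rev (traject sg a l.+1)) arr b :> pathalg k Q.
Proof.
elim: l a => [|l IHl] a; first by rewrite spath1 big_seq1.
by rewrite trajectS rev_cons -cats1 big_cat /= big_seq1 -IHl -pelt_spathS.
Qed.

Lemma cyc_spath a : cyc I a = pelt (spath a (order sg a)).
Proof. by rewrite /cyc /orbit -orderSpred prod_traject. Qed.

Lemma iter_order_mul a n : sgi (order sg a * n) a = a.
Proof.
elim: n => [|n IHn]; first by rewrite muln0.
by rewrite mulnS iterD IHn (iter_order (sigma_inj gentleI)).
Qed.

Lemma cycX_spath a n : (0 < n)%N ->
  cyc I a ^+ n = pelt (spath a (order sg a * n)).
Proof.
case: n => // n _; elim: n => [|n IHn]; first by rewrite expr1 muln1 cyc_spath.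
rewrite exprS IHn [(order _ _ * n.+2)%N]mulnSr pelt_spathD iter_order_mul.
by rewrite cyc_spath.
Qed.

Definition spath_coef (x : pathalg k Q) a l := x (spath a l).

Local Arguments spath_coef : simpl never.

Lemma pathalg_coordinates :
  path_coordinates I spath_coef (fun a l => pelt (spath a l)).
Proof.
split=> //.
- by move=> c x a l; rewrite /spath_coef -pa_scalM.
- move=> x y a l; rewrite /spath_coef Defs.coefM plen_spath; apply: eq_bigr => -[j /= jl] _.
  have [i ->] : exists i, l = (j + i)%N.
    by exists (l - j)%N; rewrite subnKC.
  by rewrite pdrop_spath ptake_spath addKn.
- by move=> x a b ab; rewrite /spath_coef !spath0 ab.
by move=> b j a l; rewrite /spath_coef peltE spath_eq.
Qed.

(** The paths P_a^l avoid the relations: subpaths of such paths are again of this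
   form, so the elements with zero coefficient at all of them form an ideal, and
   this ideal contains the generators of I. *)
Lemma spath_coef_ideal x a l : I x -> spath_coef x a l = 0.
Proof.
have [_ _ [S S2 IE]] := gentleI => xI.
have Ix : ideal_gen [set pelt p | p in S] x by rewrite -IE.
pose K : set (pathalg k Q) := [set x | forall a l, spath_coef x a l = 0].
suff : K x by apply.
have B := cfB pathalg_coordinates; have M := cfM pathalg_coordinates.
apply: Ix => [|_ [p Sp <-] b j]; first split=> [b j|y z Ky Kz b j|y z Kz].
- by rewrite (cf0 pathalg_coordinates).
- by rewrite B Ky Kz subrr.
- by split=> b j; rewrite M big1 // => i _; rewrite Kz ?mul0r ?mulr0.
rewrite /spath_coef peltE; case: eqP => // e.
have j2 : j = 2%N by rewrite -(plen_spath b j) e S2.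
case: (sigmaP gentleI (b := b)); rewrite /arr -[in pelt (arrow_path (sg b))]spath1 -pelt_spathS -j2 e IE.
by apply: ideal_gen_sub; exists p.
Qed.

(** An arrow b can be followed by sigma(b) only, unless the product lies in I. *)
Lemma string_or_zero p : (exists a l, p = spath a l) \/ I (pelt p).
Proof.
have idI := gentle_ideal gentleI.
elim: {p}_.+1 {-2}p (ltnSn (plen p)) => // n IHn p hp.
have [p0|p0] := posnP (plen p).
  have [d dP] := arrow_at gentleI; left; exists (d p.1), 0%N.
  rewrite spath0 dP; apply: val_inj => /=.
  by case: p p0 {hp} => [[i [|]]].
have [a pa] : exists a, ptake 1 p = arrow_path a.
  case: p p0 {hp} => [[i [|a s]] /= h] // _; exists a; apply: val_inj => /=.
  by case/andP: (h) => /eqP <-; rewrite take0.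
have pE : pelt p = pelt (pdrop 1 p) * arr a :> pathalg k Q.
  by rewrite -(@pelt_cat _ _ 1) // pa.
have [|[b [l pb]]|pI] := IHn (pdrop 1 p).
- by rewrite plen_pdrop ltn_subLR // ltnS.
- case: l pb => [|l] pb.
    left; exists a, 1%N; apply: (@cat_inj _ _ 1 _ 1) => //.
      by rewrite pa spath1; apply: val_inj.
    rewrite pb -[1%N in RHS](addn0 1) pdrop_spath; apply/eqP.
    rewrite spath_eq /= (source_sigma gentleI).
    move/(congr1 (fun q : qpath Q => (path_data q).1)): pb.
    by rewrite /= pa => /= <-.
  have [bs|bs] := eqVneq b (sg a).
    left; exists a, l.+2; apply: (@cat_inj _ _ 1 _ 1) => //.
      by rewrite pa -[l.+2]add1n ptake_spath spath1.
    by rewrite pb -[l.+2]add1n pdrop_spath bs.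
  right; rewrite pE pb pelt_spathS -mulrA; apply: ideal_mull => //.
  by apply: contrapT => /(sigma_uniq gentleI) e; rewrite e eqxx in bs.
by right; rewrite pE; apply: ideal_mulr.
Qed.

Definition spath_trunc n (x : pathalg k Q) : pathalg k Q :=
  \sum_i scal (x (trivial_path i)) * vtx i +
  \sum_a \sum_(j < n) scal (spath_coef x a j.+1) * pelt (spath a j.+1).

(** Together with [spath_coef_ideal]: the paths P_a^l form a basis of kQ/I. *)
Lemma spath_trunc_mod x : exists n0, forall n, (n0 <= n)%N -> I (x - spath_trunc n x).
Proof.
have idI := gentle_ideal gentleI.
have tD n y z : spath_trunc n (y + z) = spath_trunc n y + spath_trunc n z.
  rewrite /spath_trunc addrACA -!big_split; congr (_ + _); apply: eq_bigr => a _ /=.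
    by rewrite -mulrDl -raddfD.
  rewrite -big_split; apply: eq_bigr => j _ /=.
  by rewrite -mulrDl -raddfD.
have tZ n c y : spath_trunc n (scal c * y) = scal c * spath_trunc n y.
  have e p : (scal c * y : pathalg k Q) p = c * y p := pa_scalM _ _ _.
  rewrite /spath_trunc mulrDr !mulr_sumr; congr (_ + _); apply: eq_bigr => a _.
    by rewrite e rmorphM mulrA.
  rewrite mulr_sumr; apply: eq_bigr => j _.
  by rewrite (cfZ pathalg_coordinates) rmorphM mulrA.
elim/pathalg_ind: x.
- exists 0%N => n _; have -> : spath_trunc n 0 = 0.
    by have := tZ n 0 0; rewrite raddf0 !mul0r.
  by rewrite subrr; case: idI.
- move=> x y [n1 h1] [n2 h2]; exists (maxn n1 n2) => n; rewrite geq_max => /andP[le1 le2].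
  by rewrite tD opprD addrACA; apply: is_idealD; [|exact: h1|exact: h2].
- move=> c x [n1 h1]; exists n1 => n /h1 h; rewrite tZ -mulrBr.
  exact: ideal_mull.
move=> p; case: (string_or_zero p) => [[a [l ->]]|pI]; last first.
  exists 0%N => n _.
  have -> : spath_trunc n (pelt p) = 0.
    have c0 := spath_coef_ideal _ _ pI; have [d dP] := arrow_at gentleI.
    rewrite /spath_trunc !big1 ?addr0 // => [a _|i _].
      by rewrite big1 // => j _; rewrite c0 raddf0 mul0r.
    by rewrite -(dP i) -spath0 [pelt p _]c0 raddf0 mul0r.
  by rewrite subr0.
exists l => n ln; suff -> : spath_trunc n (pelt (spath a l)) = pelt (spath a l).
  by rewrite subrr; case: idI.
have cp := cf_pe pathalg_coordinates a l.
have cp' b j : pelt (spath a l) (spath b j) = _ :> k := cp b j.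
have scal_bool (b : bool) (x : pathalg k Q) :
    scal (b%:R : k) * x = if b then x else 0.
  by case: b; rewrite ?raddf0 ?mul0r // rmorph1 mul1r.
rewrite /spath_trunc; case: l ln cp cp' => [|l] ln cp cp'.
  rewrite (bigD1 (source a)) //= big1 ?addr0 => [|i ia]; last first.
    have [d dP] := arrow_at gentleI.
    by rewrite -{1}(dP i) -spath0 cp' scal_bool /= dP (negPf ia).
  rewrite [X in _ + X]big1 ?addr0 => [|b _]; last first.
    by rewrite big1 // => j _; rewrite cp scal_bool.
  by rewrite -spath0 cp' scal_bool /= eqxx spath0.
rewrite big1 ?add0r => [|i _]; last first.
  have [d dP] := arrow_at gentleI.
  by rewrite -{1}(dP i) -spath0 cp' scal_bool.
rewrite (bigD1 a) //= [X in _ + X]big1 ?addr0 => [|b ba]; last first.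
  by rewrite big1 // => j _; rewrite cp scal_bool /= (negPf ba) andbF.
rewrite (bigD1 (Ordinal ln)) //= big1 ?addr0 => [|j jl]; last first.
  rewrite cp scal_bool /= eqSS; case: eqP => // e.
  by case/eqP: jl; apply: val_inj.
by rewrite cp scal_bool /= !eqxx.
Qed.

Variables (m : sorbits I -> nat) (m_gt0 : forall v, (0 < m v)%N).

(** This is N(a), the length of the cycle c_a^(m(v_a)). *)
Definition socle_length a : nat := (order sg a * m (sorbit_of I a))%N.
Local Notation N := socle_length.

Lemma socle_length_gt0 a : (0 < N a)%N.
Proof. by rewrite muln_gt0 m_gt0 -orderSpred. Qed.

Lemma socle_length_sigma a : N (sg a) = N a.
Proof. by rewrite /N (order_sigma gentleI) (sorbit_sigma gentleI). Qed.

Lemma iter_socle_length a : sgi (N a) a = a.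
Proof. exact: iter_order_mul. Qed.

Lemma cycX_socle a : cyc I a ^+ m (sorbit_of I a) = pelt (spath a (N a)).
Proof. exact: cycX_spath. Qed.

Local Notation brauer_relations := [set x + y | x in I & y in Jminus m].

(** Modulo I + J_-, all P_a^l with l > N(a) vanish: as P_a^N(a) = P_b^N(b) for the
   other arrow b at the source of a, the arrow a composed with it is both
   P_a^(N(a)+1) and zero.  The remaining socle coefficients are collected on one
   arrow d i per vertex. *)
Lemma brauer_kernel x : ideal_gen brauer_relations x <->
  form_kernel spath_coef N (fun=> 1) x.
Proof.
have cP := pathalg_coordinates.
have idI := gentle_ideal gentleI.
set G := ideal_gen _; have idG : is_ideal G := ideal_gen_ideal _.
have idJ : is_ideal (Jminus m) := ideal_gen_ideal _.
have idK := form_kernel_ideal gentleI cP (fun=> 1)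
  socle_length_gt0 socle_length_sigma iter_socle_length.
have IG y : I y -> G y.
  move=> Iy; apply: ideal_gen_sub; exists y => //; exists 0; rewrite ?addr0 //.
  by case: idJ.
have JG y : Jminus m y -> G y.
  move=> Jy; apply: ideal_gen_sub; exists 0; last by exists y; rewrite ?add0r.
  by case: idI.
split=> [Gx|[x0 xs]].
  apply: Gx => // _ [y Iy [z Jz <-]]; apply: is_idealD => //.
    by split=> [a l _|i]; [|rewrite big1 // => a _]; rewrite spath_coef_ideal ?mulr0.
  apply: Jz => // _ [a [b [ab ->]]]; rewrite !cycX_socle.
  split=> [c l lc|i].
    rewrite (cfB cP) !(cf_pe cP).
    have e u : (l == N u) && (if N u == 0%N then source c == source u else c == u) = false.
      rewrite eqn0Ngt socle_length_gt0 /=.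
      by apply/negP => /andP[/eqP lu /eqP cu]; rewrite lu -cu ltnn in lc.
    by rewrite !e subrr.
  under eq_bigr => c _ do rewrite mul1r (cfB cP) !(cf_pe cP).
  have e u : \sum_(c | source c == i) ((N c == N u) &&
      (if N u == 0%N then source c == source u else c == u))%:R =
      (source u == i)%:R :> k.
    rewrite eqn0Ngt socle_length_gt0 /= big_mkcond (bigD1 u) //= !eqxx /=.
    rewrite big1 ?addr0 => [|c cu]; last by rewrite (negPf cu) andbF if_same.
    by case: ifP.
  by rewrite sumrB !e ab subrr.
have PG a l : (N a < l)%N -> G (pelt (spath a l)).
  move=> la; have -> : l = (N a + (l - (N a).+1).+1)%N by rewrite subnSK // subnKC // ltnW.
  rewrite pelt_spathD iter_socle_length pelt_spathS -mulrA; apply: (ideal_mull _ idG).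
  have [b [ba ab _ _]] := source_pair a.
  have -> : arr a * pelt (spath a (N a)) =
      (arr a : pathalg k Q) * (pelt (spath a (N a)) - pelt (spath b (N b))) + arr a * pelt (spath b (N b)).
    by rewrite mulrBr subrK.
  apply: (is_idealD idG).
    apply: (ideal_mull _ idG); apply: JG; apply: ideal_gen_sub.
    by exists a, b; rewrite !cycX_socle ab.
  apply: IG; rewrite -(prednK (socle_length_gt0 b)) -addn1 pelt_spathD spath1 mulrA.
  apply: (ideal_mulr _ idI); apply: contrapT => /(sigma_uniq gentleI).
  by rewrite -iterS prednK ?socle_length_gt0 // iter_socle_length => e; rewrite e eqxx in ba.
have [d dP] := arrow_at gentleI.
have [n0 n0P] := spath_trunc_mod x; pose n := (n0 + \max_a N a)%N.
have nN a : (N a <= n)%N by rewrite (leq_trans (leq_bigmax a)) // leq_addl.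
rewrite -(subrK (spath_trunc n x) x); apply: (is_idealD idG).
  by apply: IG; apply: n0P; rewrite leq_addr.
pose D i := pelt (spath (d i) (N (d i))) : pathalg k Q.
have -> : spath_trunc n x = \sum_a (\sum_(j < n)
    scal (spath_coef x a j.+1) * pelt (spath a j.+1) - scal (spath_coef x a (N a)) * D (source a)).
  rewrite sumrB /spath_trunc addrC; congr (_ + _); rewrite big1 => [|i _].
    symmetry; apply/eqP; rewrite oppr_eq0 (partition_big (@source Q) predT) //= big1 // => i _.
    rewrite (eq_bigr (fun a => scal (spath_coef x a (N a)) * D i)) => [|a /eqP -> //].
    rewrite -mulr_suml -raddf_sum; have := xs i.
    by under eq_bigr do rewrite mul1r; move=> ->; rewrite raddf0 mul0r.
  by rewrite -(dP i) -spath0 [x _](x0 (d i) 0%N) ?socle_length_gt0 // raddf0 mul0r.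
apply: (@ideal_sum _ G _ (index_enum _) xpredT _ idG) => a _.
have hN : ((N a).-1 < n)%N by rewrite prednK ?socle_length_gt0.
rewrite (bigD1 (Ordinal hN)) //= prednK ?socle_length_gt0 // addrAC -mulrBr.
apply: (is_idealD idG).
  apply: (ideal_mull _ idG); apply: JG; apply: ideal_gen_sub.
  by exists a, (d (source a)); rewrite dP !cycX_socle.
apply: (@ideal_sum _ G _ (index_enum _) (fun j => j != Ordinal hN) _ idG) => j jN; have [lt|gt|e] := ltngtP j.+1 (N a).
- by rewrite x0 // raddf0 mul0r; case: idG.
- by apply: (ideal_mull _ idG); apply: PG.
by case/eqP: jN; apply: val_inj; rewrite /= -e.
Qed.

Lemma brauer_quotient_symmetric : symmetric_algebra (quot brauer_relations).
Proof.
have nd := quot_form_frobenius gentleI pathalg_coordinates socle_length_gt0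
  socle_length_sigma iter_socle_length (fun=> oner_neq0 k) brauer_kernel.
apply/symmetric_algebraP; eexists; first exact: nd.
move=> x y; apply: (quot_form_twisted gentleI pathalg_coordinates socle_length_sigma
  iter_socle_length _ _ (s := idfun) (r := fun _ _ => 1)) => [a|c|b l _|b l _].
- exact: oner_neq0.
- by [].
- by rewrite -[LHS]mul1r; congr (_ * _); symmetry; exact: scal_monoid.1.
- by rewrite mul1r.
Qed.

End StringPaths.

(** * Coordinates on the completed algebra *)

Lemma ideal_exp_le (A : pzRingType) (J : set A) n n' :
  (n <= n')%N -> ideal_exp J n' `<=` ideal_exp J n.
Proof.
move=> /subnKC <-; elim: (n' - n)%N => [|i IHi]; first by rewrite addn0.
by rewrite addnS => x /ideal_exp_subS; exact: IHi.
Qed.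

Lemma level_le (k : comPzRingType) (B : algebraOver k) (J : set B)
    (x : completion J) n n' b : (n <= n')%N -> x n' = qproj b -> x n = qproj b.
Proof.
move=> /subnKC <-; elim: (n' - n)%N => [|i IHi]; first by rewrite addn0.
rewrite addnS => e; apply: IHi.
have /asboolP/(_ (n + i)%N) <- := level_coherent x.
by rewrite e transitionE.
Qed.

Section RibbonCoordinates.
Variables (k : fieldType) (Q : quiver) (I : set (pathalg k Q)).
Hypothesis gentleI : complete_gentle I.
Local Notation sg := (sigma I).
Local Notation sgi j a := (iter j (sigma I) a).
Local Notation J := (arrow_ideal I).
Local Notation spath := (spath gentleI).
Local Notation spath_coef := (spath_coef gentleI).
Local Notation R := (ribbon_algebra I).

Definition quot_coef (u : quot I) a l : k := spath_coef (repr u) a l.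

Lemma quot_coefE x a l : quot_coef (qproj x) a l = spath_coef x a l.
Proof.
apply/eqP; rewrite -subr_eq0 -(cfB (pathalg_coordinates gentleI)); apply/eqP.
apply: spath_coef_ideal; apply/(qproj_eq0 gentleI).
by rewrite raddfB /= qrepr subrr.
Qed.

Lemma quot_coordinates :
  path_coordinates I quot_coef (fun a l => qproj (pelt (spath a l))).
Proof.
have cP := pathalg_coordinates gentleI.
split=> [u v a l|c u a l|u v a l|u a b|b j a l].
- rewrite -(qrepr u) -(qrepr v) -raddfB !quot_coefE; exact: (cfB cP).
- rewrite -(qrepr u) -[scal c * _](rmorphM qproj) !quot_coefE; exact: (cfZ cP).
- rewrite -(qrepr u) -(qrepr v) -rmorphM quot_coefE (cfM cP).
  by apply: eq_bigr => j _; rewrite !quot_coefE.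
- by rewrite -(qrepr u) !quot_coefE; exact: (cf_source cP).
- by rewrite quot_coefE; exact: (cf_pe cP).
Qed.

Lemma arrow_ideal_exp_coef n u a l :
  ideal_exp J n u -> (l < n)%N -> quot_coef u a l = 0.
Proof.
have cP := quot_coordinates.
have idJ0 j : is_ideal [set v : quot I | forall a l, (l < j)%N -> quot_coef v a l = 0].
  split=> [b i _|v v' v0 v'0 b i ij|v v' v'0]; first by rewrite (cf0 cP).
    by rewrite (cfB cP) v0 ?v'0 ?subrr.
  split=> b i ij; rewrite (cfM cP) big1 // => [[h /= hi] _].
    by rewrite v'0 ?mulr0 // (leq_ltn_trans _ ij).
  by rewrite v'0 ?mul0r // (leq_ltn_trans _ ij) // leq_subr.
have J1 v : J v -> forall b, quot_coef v b 0 = 0.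
  move=> Jv b; suff : [set v : quot I | forall a l, (l < 1)%N -> quot_coef v a l = 0] v.
    exact.
  apply: Jv; first exact: idJ0.
  move=> _ [c _ <-] b' [|//] _.
  by rewrite /arr -(spath1 gentleI) (cf_pe cP).
move=> Ju ln.
suff : [set v : quot I | forall a l, (l < n)%N -> quot_coef v a l = 0] u by exact.
elim: n u {ln} Ju => [//|n IHn] u Ju; apply: Ju; first exact: idJ0.
move=> _ [v Jv [v' Jv' <-]] b i ib; rewrite (cfM cP) big1 // => -[[|j] /= ji] _.
  by rewrite [X in _ * X]J1 ?mulr0.
rewrite IHn ?mul0r //; have : (i - j.+1 < n)%N; last by [].
by rewrite ltn_subLR // addSn ltnS (leq_trans _ (leq_addl _ _)).
Qed.

Lemma arrow_ideal_exp_path a l : ideal_exp J l (qproj (pelt (spath a l))).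
Proof.
elim: l a => [//|l IHl] a; rewrite pelt_spathS rmorphM.
apply: ideal_gen_sub; exists (qproj (pelt (spath (sg a) l))); first exact: IHl.
by exists (qproj (arr a)) => //; apply: ideal_gen_sub; exists a.
Qed.

(** With its converse [arrow_ideal_exp_coef], this identifies the arrow-adic
   filtration with the filtration by length, so that elements of the completion
   are the arbitrary families of coefficients. *)
Lemma arrow_ideal_expP n u :
  (forall a l, (l < n)%N -> quot_coef u a l = 0) -> ideal_exp J n u.
Proof.
move=> u0; have idJ := ideal_exp_ideal J n.
rewrite -(qrepr u) in u0 *; move: (repr u) u0 => x x0.
have xc a l : (l < n)%N -> spath_coef x a l = 0 by rewrite -quot_coefE; exact: x0.
have [n0 h] := spath_trunc_mod gentleI x.
have -> : qproj x = qproj (spath_trunc gentleI n0 x) :> quot I.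
  by apply/eqP; rewrite -subr_eq0 -raddfB; apply/eqP/(qproj_eq0 gentleI)/h.
have pJ a l : ideal_exp J n (qproj (scal (spath_coef x a l) * pelt (spath a l))).
  have [ln|nl] := ltnP l n; last first.
    rewrite rmorphM; apply: (ideal_mull _ idJ).
    exact: ideal_exp_le nl _ (arrow_ideal_exp_path a l).
  by rewrite xc // raddf0 mul0r raddf0; case: idJ.
have [d dP] := arrow_at gentleI.
rewrite raddfD !raddf_sum; apply: (is_idealD idJ).
  apply: (@ideal_sum _ (ideal_exp J n) _ (index_enum _) xpredT _ idJ) => i _.
  have e : trivial_path i = spath (d i) 0 by rewrite spath0 dP.
  rewrite /vtx e; exact: pJ.
apply: (@ideal_sum _ (ideal_exp J n) _ (index_enum _) xpredT _ idJ) => a _.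
rewrite raddf_sum.
by apply: (@ideal_sum _ (ideal_exp J n) _ (index_enum _) xpredT _ idJ) => j _; exact: pJ.
Qed.

(** Level l + 1 is the first level that sees paths of length l. *)
Definition ribbon_coef (x : R) a l : k := quot_coef (repr (x l.+1)) a l.

Lemma ribbon_coefE (x : R) n b a l : x n = qproj b -> (l < n)%N ->
  ribbon_coef x a l = quot_coef b a l.
Proof.
move=> e ln; have {}e : x l.+1 = qproj b by apply: level_le e.
apply/eqP; rewrite -subr_eq0 -(cfB quot_coordinates); apply/eqP.
apply: (@arrow_ideal_exp_coef l.+1) => //.
rewrite -[X in X _]ideal_gen_id; last exact: ideal_exp_ideal.
by apply/qprojP; rewrite qrepr.
Qed.

Lemma ribbon_coef_path x a l : ribbon_coef (of_path I x) a l = spath_coef x a l.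
Proof. by rewrite (@ribbon_coefE _ l.+1 (qproj x)) // quot_coefE. Qed.

Lemma ribbon_coordinates :
  path_coordinates I ribbon_coef (fun a l => of_path I (pelt (spath a l))).
Proof.
have cP := quot_coordinates.
split=> [x y a l|c x a l|x y a l|x a b ab|b j a l].
- rewrite (@ribbon_coefE _ l.+1 (repr (x l.+1) - repr (y l.+1))) ?(cfB cP) //.
  by rewrite raddfB /= !qrepr.
- have e : (scal c * x : R) l.+1 = qproj (scal c * repr (x l.+1)).
    by rewrite rmorphM /= !qrepr.
  by rewrite (ribbon_coefE a e (ltnSn l)) (cfZ cP).
- rewrite (@ribbon_coefE _ l.+1 (repr (x l.+1) * repr (y l.+1))).
  + rewrite (cfM cP); apply: eq_bigr => -[j /= jl] _; congr (_ * _); symmetry.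
      by apply: (@ribbon_coefE _ l.+1); rewrite ?qrepr // ltnS leq_subr.
    by apply: (@ribbon_coefE _ l.+1); rewrite ?qrepr.
  + by rewrite rmorphM /= !qrepr.
  + by [].
- exact: (cf_source cP).
- by rewrite ribbon_coef_path (cf_pe (pathalg_coordinates gentleI)).
Qed.

Lemma ribbon_coef_inj (x y : R) :
  (forall a l, ribbon_coef x a l = ribbon_coef y a l) -> x = y.
Proof.
move=> e; apply: completion_ext => n; rewrite -(qrepr (x n)) -(qrepr (y n)).
apply/qprojP; apply: ideal_gen_sub; apply: arrow_ideal_expP => a l ln.
rewrite (cfB quot_coordinates).
rewrite -(@ribbon_coefE x n) ?qrepr // -(@ribbon_coefE y n) ?qrepr //.
by rewrite e subrr.
Qed.

(** This is where completeness enters: division by z needs infinite sums. *)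
Lemma ribbon_coef_surj (c : arrow Q -> nat -> k) :
  (forall a b, source a = source b -> c a 0 = c b 0) ->
  exists x, forall a l, ribbon_coef x a l = c a l.
Proof.
move=> cS.
have /choice[y yE] : forall n, exists y, forall a l, (l <= n)%N ->
    spath_coef y a l = c a l.
  move=> n; have [d h] := interpolation gentleI (pathalg_coordinates gentleI)
    (fun=> n) cS; by eexists; exact: h.
have coh : `[< coherent (fun n => qproj (qproj (y n)) : tower J n) >].
  apply: coherentP => n; exists (qproj (y n.+1)); split=> //.
  apply/qprojP; apply: ideal_gen_sub; apply: arrow_ideal_expP => a l ln.
  by rewrite -raddfB quot_coefE (cfB (pathalg_coordinates gentleI)) !yE ?subrr ?(leqW (ltnW ln)) ?(ltnW ln).
exists (Completion coh) => a l.
by rewrite (@ribbon_coefE _ l.+1 (qproj (y l.+1))) // quot_coefE yE.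
Qed.

Lemma ribbon_coef1 a l : ribbon_coef 1 a l = (l == 0)%:R.
Proof.
have -> : (1 : R) = of_path I 1 by rewrite /of_path !rmorph1.
by rewrite ribbon_coef_path /spath_coef -[l in RHS](plen_spath gentleI a).
Qed.

Variables (m : sorbits I -> nat) (m_gt0 : forall v, (0 < m v)%N).
Local Notation N := (socle_length m).
Let N_gt0 := socle_length_gt0 m_gt0.
Let N_sigma := socle_length_sigma gentleI m.
Let sigma_N := iter_socle_length gentleI m.

Lemma ribbon_coef_z a l : ribbon_coef (zelt m) a l = (l == N a)%:R.
Proof.
have cP := ribbon_coordinates.
rewrite /zelt (cf_sum cP) (bigD1 a) //= big1 ?addr0 => [|b ba].
  rewrite /of_path -!rmorphXn /= (cycX_socle gentleI m_gt0) (cf_pe cP).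
  by rewrite eqn0Ngt N_gt0 /= eqxx andbT.
rewrite /of_path -!rmorphXn /= (cycX_socle gentleI m_gt0) (cf_pe cP).
by rewrite eqn0Ngt N_gt0 /= [a == b]eq_sym (negPf ba) andbF.
Qed.

Lemma ribbon_coef_zM x a l : ribbon_coef (zelt m * x) a l =
  if (N a <= l)%N then ribbon_coef x a (l - N a)%N else 0.
Proof.
have cP := ribbon_coordinates; rewrite (cfM cP).
have e j : ribbon_coef (zelt m) (sgi j a) (l - j)%N = ((l - j)%N == N a)%:R.
  by rewrite ribbon_coef_z; congr (_ == _)%:R; elim: j => //= j <-; rewrite N_sigma.
under eq_bigr do rewrite e.
case: leqP => [Nl|lN]; last first.
  rewrite big1 // => j _; case: eqP => [h|]; last by rewrite mul0r.
  by move: lN; rewrite -h ltnNge leq_subr.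
have hj : (l - N a < l.+1)%N by rewrite ltnS leq_subr.
rewrite (bigD1 (Ordinal hj)) //= subKn // eqxx mul1r big1 ?addr0 // => j jl.
case: eqP => [h|]; last by rewrite mul0r.
by case/eqP: jl; apply: val_inj; rewrite /= -h subKn // -ltnS.
Qed.

Lemma ribbon_coef_zXM i x a l : ribbon_coef (zelt m ^+ i * x) a l =
  if (i * N a <= l)%N then ribbon_coef x a (l - i * N a)%N else 0.
Proof.
elim: i l => [|i IHi] l; first by rewrite mul1r mul0n subn0.
rewrite exprS -mulrA ribbon_coef_zM IHi mulSn.
case: leqP => [Nl|lN]; last by rewrite leqNgt (leq_trans lN) ?leq_addr.
by rewrite leq_subRL // subnDA.
Qed.

Local Notation Lambda := (ribbon_order gentleI m_gt0).

(** Powers of z beyond l do not reach length l, so the sum can be cut at l. *)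
Lemma ribbon_coef_scalM (c : pseries k) (x : Lambda) a l :
  ribbon_coef (scal c * x : Lambda) a l =
  \sum_(i < l.+1) c i * ribbon_coef (zelt m ^+ i * x) a l.
Proof.
have cP := ribbon_coordinates.
have -> : \sum_(i < l.+1) c i * ribbon_coef (zelt m ^+ i * x) a l =
    ribbon_coef (\sum_(i < l.+1) scal (c i) * (zelt m ^+ i * x)) a l.
  by rewrite (cf_sum cP); apply: eq_bigr => i _; rewrite (cfZ cP).
pose b := ps_trunc (zquot m) c l.+1 * repr (level x l.+1) : quot I.
suff [e1 e2] : (scal c * x : Lambda) l.+1 = qproj b :> tower J l.+1 /\
    level (\sum_(i < l.+1) scal (c i) * (zelt m ^+ i * x) : R) l.+1 = qproj b.
  by rewrite (ribbon_coefE a e1 (ltnSn l)) (ribbon_coefE a e2 (ltnSn l)).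
split; first by rewrite /b rmorphM /= qrepr.
have lev T (r : seq T) (F : T -> R) :
    level (\sum_(i <- r) F i) l.+1 = \sum_(i <- r) level (F i) l.+1.
  by apply: (big_morph (fun y : R => level y l.+1)) => //; exact: raddf0.
rewrite lev /b /ps_trunc mulr_suml raddf_sum; apply: eq_bigr => i _.
by rewrite zeltE -rmorphXn -mulrA /= rmorphM /= rmorphM /= qrepr.
Qed.

Definition ps_const (c : k) : pseries k := fun n => if n is 0 then c else 0.

(** The k-algebra structure of Lambda is the restriction of the k[[t]]-algebra
   structure along the constants. *)
Lemma scal_ps_const c : (scal (ps_const c) : Lambda) = (scal c : R) :> R.
Proof.
have cP := ribbon_coordinates.
apply: ribbon_coef_inj => a l.
rewrite -[scal (ps_const c) : Lambda]mulr1 ribbon_coef_scalM.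
rewrite -[scal c : R]mulr1 (cfZ cP) big_ord_recl /= mul1r big1 ?addr0 // => i _.
by rewrite mul0r.
Qed.

End RibbonCoordinates.

(** * The twisted Brauer graph algebra *)

Lemma rmorphism_bundle (A B : pzRingType) (f : A -> B) :
  zmod_morphism f -> monoid_morphism f -> exists F : {rmorphism A -> B}, F =1 f.
Proof.
move=> fB fM; pose m1 := GRing.isZmodMorphism.Build A B f fB.
pose m2 := GRing.isMonoidMorphism.Build A B f fM.
by pose F : {rmorphism A -> B} := HB.pack f m1 m2; exists F.
Qed.

Section TwistedBrauer.
Variables (k : fieldType) (Q : quiver) (I : set (pathalg k Q)).
Hypothesis gentleI : complete_gentle I.
Variables (m : sorbits I -> nat) (m_gt0 : forall v, (0 < m v)%N).
Variables (eps : arrow Q -> bool) (polar_eps : polarization eps).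
Local Notation sg := (sigma I).
Local Notation sgi j a := (iter j (sigma I) a).
Local Notation spath := (spath gentleI).
Local Notation R := (ribbon_algebra I).
Local Notation Lambda := (ribbon_order gentleI m_gt0).
Local Notation A := (twisted_brauer_algebra m).
Local Notation N := (socle_length m).
Let N_gt0 := socle_length_gt0 m_gt0.
Let N_sigma := socle_length_sigma gentleI m.
Let sigma_N := iter_socle_length gentleI m.
Let cP := ribbon_coordinates gentleI.
Local Notation rcf := (ribbon_coef gentleI).

Definition polar_weight (a : arrow Q) : k := signed (eps a) 1.
Local Notation w := polar_weight.

Lemma polar_weight_sqr a : w a * w a = 1.
Proof. by rewrite /w /signed; case: (eps a); rewrite ?mulrNN mulr1. Qed.

Lemma polar_weight_neq0 a : w a != 0.
Proof.
apply: contra_eq_neq (polar_weight_sqr a) => ->.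
by rewrite mul0r eq_sym oner_neq0.
Qed.

Lemma polar_weight_opp a b : b != a -> source b = source a -> w b = - w a.
Proof.
move=> ba sba; have := polar_eps ba sba; rewrite /w /signed.
by case: (eps a); case: (eps b); rewrite ?opprK.
Qed.

(** The quotient y by z is obtained by shifting coefficients; its coefficient at an
   idempotent is well defined since the socle condition with opposite weights says
   that both arrows at the vertex give the same value. *)
Lemma z_ideal_kernel (x : R) :
  form_kernel rcf N w x -> exists y : R, x = zelt m * y.
Proof.
case=> x0 xs.
have [a b ab|y yE] := @ribbon_coef_surj _ _ _ gentleI (fun a l => rcf x a (l + N a)%N).
  rewrite !add0n; have [->//|ba] := eqVneq b a.
  have [b' [b'a sb' two sum]] := source_pair gentleI a.
  have bb' : b = b' by case: (two b (esym ab)) ba => // ->; rewrite eqxx.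
  have := xs (source a); rewrite sum -bb' (polar_weight_opp ba) // mulNr -mulrBr.
  by move/eqP; rewrite mulf_eq0 (negPf (polar_weight_neq0 a)) subr_eq0 => /eqP.
exists y; apply: (@ribbon_coef_inj k Q I gentleI) => a l.
rewrite (ribbon_coef_zM gentleI m_gt0) yE; case: leqP => [Nl|lN].
  by rewrite subnK.
exact: x0.
Qed.

Lemma twisted_brauer_kernel x :
  ideal_gen [set zelt m * y | y in [set: R]] x <-> form_kernel rcf N w x.
Proof.
split=> [|/z_ideal_kernel[y ->]]; last by apply: ideal_gen_sub; exists y.
  move=> h; apply: h; first exact: (form_kernel_ideal gentleI cP w N_gt0 N_sigma sigma_N).
move=> _ [y _ <-]; split=> [a l la|i].
  by rewrite (ribbon_coef_zM gentleI m_gt0) leqNgt la.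
have [d dP] := arrow_at gentleI.
have [b [ba sb _ sum]] := source_pair gentleI (d i).
rewrite -{1}(dP i) sum !(ribbon_coef_zM gentleI m_gt0) !leqnn !subnn.
by rewrite (polar_weight_opp ba sb) (cf_source cP y sb) mulNr subrr.
Qed.

Definition twisted_form : dual A := quot_form cP twisted_brauer_kernel.

Lemma twisted_formE x : twisted_form (qproj x) = socle_form rcf N w x.
Proof. exact: quot_formE. Qed.

Lemma twisted_form_frobenius : frobenius twisted_form.
Proof.
exact: (quot_form_frobenius gentleI cP N_gt0 N_sigma sigma_N polar_weight_neq0).
Qed.

(** * The polarization involution *)

(** The sign with which the involution acts on the path P_a^l.  It is the product
   of eps_(sigma(b)) eps_b over the arrows b of the path, which telescopes. *)
Definition path_sign a l : k := w (sgi l a) * w a.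

Lemma path_signD a i j : path_sign (sgi i a) j * path_sign a i = path_sign a (i + j).
Proof.
by rewrite /path_sign -mulrA (mulrA (w (sgi i a))) polar_weight_sqr mul1r -iterD addnC.
Qed.

Lemma path_sign0 a : path_sign a 0 = 1.
Proof. exact: polar_weight_sqr. Qed.

Lemma path_sign_sqr a l : path_sign a l * path_sign a l = 1.
Proof. by rewrite /path_sign mulrACA !polar_weight_sqr mulr1. Qed.

Lemma path_sign_cycle a i : path_sign a (i * N a) = 1.
Proof.
have e : sgi (i * N a) a = a.
  by elim: i => // i IHi; rewrite mulSn iterD IHi sigma_N.
by rewrite /path_sign e polar_weight_sqr.
Qed.

(** Rescaling the coefficients by [path_sign] is multiplicative since the signs are,
   and k[[t]]-linear since the paths in powers of z are closed, with sign +. *)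
Lemma polar_involution_exists :
  exists f : Lambda -> Lambda, is_polar_involution gentleI m_gt0 eps f.
Proof.
have /choice[f fE] : forall x : R, exists y : R, forall a l, rcf y a l = path_sign a l * rcf x a l.
  move=> x; apply: ribbon_coef_surj => a b ab.
  by rewrite !path_sign0 (cf_source cP x ab).
have path_f a l : f (of_path I (pelt (spath a l))) =
    (scal (path_sign a l) : R) * of_path I (pelt (spath a l)).
  apply: (@ribbon_coef_inj k Q I gentleI) => b j; rewrite fE (cfZ cP) (cf_pe cP).
  case: (eqVneq j l) => [->|] /=; last by rewrite !mulr0.
  case: eqP => [->|_].
    by rewrite !path_sign0.
  by case: eqP => [->//|]; rewrite !mulr0.
exists f; split; first split.
- move=> x y; apply: (@ribbon_coef_inj k Q I gentleI) => a l.
  by rewrite fE !(cfB cP) !fE mulrBr.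
- split=> [|x y]; apply: (@ribbon_coef_inj k Q I gentleI) => a l.
    rewrite fE !ribbon_coef1; case: l => [|l]; last by rewrite mulr0.
    by rewrite path_sign0 mul1r.
  rewrite fE !(cfM cP) mulr_sumr; apply: eq_bigr => -[j /= jl] _.
  by rewrite !fE [RHS]mulrACA path_signD subnKC.
- move=> c; apply: (@ribbon_coef_inj k Q I gentleI) => a l; rewrite fE.
  rewrite -[scal c]mulr1 ribbon_coef_scalM mulr_sumr; apply: eq_bigr => i _.
  rewrite (ribbon_coef_zXM gentleI m_gt0); case: leqP => [il|]; last by rewrite !mulr0.
  rewrite ribbon_coef1 subn_eq0; case: leqP => [li|]; last by rewrite !mulr0.
  have -> : path_sign a l = path_sign a (i * N a).
    by congr path_sign; apply/eqP; rewrite eqn_leq il li.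
  by rewrite path_sign_cycle mul1r.
- move=> i; have [d dP] := arrow_at gentleI.
  have -> : vtx i = pelt (spath (d i) 0) :> pathalg k Q by rewrite spath0 dP.
  rewrite path_f path_sign0; have -> : scal (1 : k) = 1 :> R by exact: scal_monoid.1.
  by rewrite mul1r.
move=> a; have -> : arr a = pelt (spath a 1) :> pathalg k Q by rewrite spath1.
rewrite path_f /path_sign /w /signed /=.
have sN (c : k) : scal (- c) = - scal c :> R by exact: raddfN.
have s1 : scal (1 : k) = 1 :> R by exact: scal_monoid.1.
by case: (eps _); case: (eps a); rewrite ?mulrNN ?mulr1 ?mul1r ?sN s1 ?mulN1r ?mul1r ?opprK.
Qed.

Lemma polar_involutionP :
  is_polar_involution gentleI m_gt0 eps (polar_involution gentleI m_gt0 eps).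
Proof. exact: xgetPex polar_involution_exists. Qed.

Lemma polar_involution_path (f : Lambda -> Lambda) a l :
  is_polar_involution gentleI m_gt0 eps f ->
  f (of_path I (pelt (spath a l))) =
    (scal (path_sign a l) : R) * of_path I (pelt (spath a l)).
Proof.
case=> [[_ [_ fM] _] fv fa].
have sN (c : k) : scal (- c) = - scal c :> R by exact: raddfN.
have s1 : scal (1 : k) = 1 :> R by exact: scal_monoid.1.
have sM (c c' : k) : scal (c * c') = scal c * scal c' :> R by exact: scal_monoid.2.
elim: l a => [|l IHl] a.
  by rewrite (spath0 gentleI) [LHS]fv path_sign0 s1 mul1r.
have e : of_path I (pelt (spath a l.+1)) =
    of_path I (pelt (spath (sg a) l)) * of_path I (arr a).
  by rewrite pelt_spathS /of_path !rmorphM.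
rewrite {1}e [LHS]fM IHl fa e -[l.+1]add1n -path_signD sM -!mulrA; congr (_ * _).
rewrite mulrA scal_central -!mulrA; congr (_ * _); rewrite /path_sign /w /signed /=.
by case: (eps _); case: (eps a); rewrite ?mulrNN ?mulr1 ?mul1r ?sN s1 ?mulN1r ?mulrN1 ?mulr1 ?mul1r ?opprK.
Qed.

Lemma twisted_form_twisted (s : {rmorphism A -> A}) : is_alg_morphism s ->
  (forall a l, s (qproj (of_path I (pelt (spath a l)))) =
     scal (path_sign a l) * qproj (of_path I (pelt (spath a l)))) ->
  forall x y, twisted_form (x * y) = twisted_form (y * s x).
Proof.
move=> [_ _ sZ] sP.
apply: (quot_form_twisted gentleI cP N_sigma sigma_N polar_weight_neq0
  twisted_brauer_kernel sZ (fun a l _ => sP a l)) => a l _.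
by rewrite /path_sign -mulrA polar_weight_sqr mulr1.
Qed.

(** Being k[[t]]-linear, the involution preserves z Lambda; on A it is determined
   by its signs on paths, since these span A. *)
Lemma twisted_involution : exists ebar : {rmorphism A -> A},
  [/\ forall x : R, ebar (qproj x) = qproj (polar_involution gentleI m_gt0 eps x),
      is_alg_morphism ebar, involutive ebar &
      forall a l, ebar (qproj (of_path I (pelt (spath a l)))) =
        scal (path_sign a l) * qproj (of_path I (pelt (spath a l)))].
Proof.
have polarP := polar_involutionP.
move: (polar_involution gentleI m_gt0 eps) polarP => f fP.
have f_path := polar_involution_path _ _ fP.
have [[fB [f1 fM] fZ] fv fa] := fP.
pose e (u : A) : A := qproj (f (repr u)).
have eE x : e (qproj x) = qproj (f x).
  apply/qprojP; rewrite -[X in ideal_gen _ X]fB.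
  have [|y ->] := @z_ideal_kernel (repr (qproj x : A) - x).
    by apply/twisted_brauer_kernel/qprojP; exact: qrepr.
  apply: ideal_gen_sub; exists (f y) => //.
  by rewrite -(scal_t gentleI m_gt0) [RHS]fM fZ.
have eB : zmod_morphism e.
  move=> u v; rewrite -(qrepr u) -(qrepr v) -raddfB !eE -raddfB.
  by congr qproj; exact: fB.
have eM : monoid_morphism e.
  split=> [|u v]; first by rewrite -(rmorph1 qproj) eE; congr qproj.
  have qM (x y : R) : qproj (x * y) = qproj x * qproj y :> A by exact: rmorphM.
  rewrite -(qrepr u) -(qrepr v) -qM !eE -qM.
  by congr qproj; exact: fM.
have [E EE] := rmorphism_bundle eB eM.
have Ec c : E (scal c) = scal c.
  rewrite EE -[scal c in LHS]/(qproj (scal c)) eE; congr qproj.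
  by rewrite -(scal_ps_const gentleI m_gt0) fZ.
have Ep a l : E (qproj (of_path I (pelt (spath a l)))) =
        scal (path_sign a l) * qproj (of_path I (pelt (spath a l))).
  by rewrite EE eE f_path rmorphM.
exists E; split=> //.
- by move=> x; rewrite EE eE.
- by split=> //; [exact: raddfB|split; [exact: rmorph1|exact: rmorphM]].
elim/(quot_path_ind gentleI cP twisted_brauer_kernel) => [|u v hu hv|c u hu|a l lN].
- by rewrite !rmorph0.
- by rewrite !rmorphD hu hv.
- by rewrite !rmorphM !Ec hu.
rewrite Ep rmorphM Ec Ep mulrA -[scal _ * scal _](scal_monoid.2) path_sign_sqr.
have -> : scal (1 : k) = 1 :> A by exact: scal_monoid.1.
by rewrite mul1r.
Qed.

(** * Symmetric orders *)

(** A lift of [twisted_form] to a k[[t]]-linear form on Lambda.  It is linear since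
   multiplication by z shifts the lengths by N(a) and the constant term that this
   introduces is the sum of the eps_a x(e_s(a)), which vanishes. *)
Definition ribbon_form (x : Lambda) : pseries k :=
  fun n => \sum_a w a * rcf x a (n.+1 * N a)%N.

Lemma ribbon_form_linear : ribbon_form \in is_form (A := Lambda).
Proof.
apply: is_formP => [x y|c x]; apply: funext => n.
  rewrite /ribbon_form [RHS]/GRing.add /= [X in _ = _ + X]/GRing.opp /= -sumrB.
  by apply: eq_bigr => a _; rewrite (cfB cP) mulrBr.
have z0 : \sum_a w a * rcf x a 0 = 0.
  have : twisted_form (qproj (zelt m * x)) = 0.
    have -> : qproj (zelt m * x) = 0 :> A.
      rewrite -(raddf0 qproj); apply/qprojP; rewrite subr0.
      by apply: ideal_gen_sub; exists x.
    exact: dual0.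
  rewrite quot_formE /socle_form => h; rewrite -[RHS]h; apply: eq_bigr => a _.
  by rewrite (ribbon_coef_zM gentleI m_gt0) leqnn subnn.
rewrite /ribbon_form [RHS]/GRing.mul /= /ps_mul.
transitivity (\sum_a w a * \sum_(i < n.+2) c i * rcf x a ((n.+1 - i) * N a)%N).
  apply: eq_bigr => a _; congr (_ * _); rewrite ribbon_coef_scalM.
  have nN : (n.+2 <= (n.+1 * N a).+1)%N by rewrite ltnS leq_pmulr.
  rewrite (big_ord_widen _ (fun i => c i * rcf x a ((n.+1 - i) * N a)%N) nN).
  rewrite [RHS]big_mkcond; apply: eq_bigr => i _.
  rewrite (ribbon_coef_zXM gentleI m_gt0) leq_pmul2r // ltnS.
  by case: leqP => _; rewrite ?mulr0 // mulnBl.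
under eq_bigr do rewrite mulr_sumr; rewrite exchange_big big_ord_recr /=.
rewrite [X in _ + X](_ : _ = 0) ?addr0; last first.
  transitivity (c n.+1 * \sum_a w a * rcf x a 0); last by rewrite z0 mulr0.
  by rewrite mulr_sumr; apply: eq_bigr => a _; rewrite subnn mul0n mulrCA.
apply: eq_bigr => i _; rewrite mulr_sumr; apply: eq_bigr => a _.
by rewrite mulrCA subSn // -ltnS.
Qed.

(** The reduction modulo t of the symmetrizing form of Lambda is a trace form on A.
   Its nondegeneracy comes from the lift of [twisted_form] being a multiple of the
   symmetrizing form. *)
Lemma symmetric_order_reduction : symmetric_algebra Lambda -> symmetric_algebra A.
Proof.
case/symmetric_algebraP => theta [_ surj] sy.
have [u uE] := surj (Dual ribbon_form_linear).
have qM (x y : R) : qproj (x * y) = qproj x * qproj y :> A by exact: rmorphM.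
pose psi (v : A) : k := theta (repr v : Lambda) 0%N.
have psiE x : psi (qproj x) = theta x 0%N.
  have [|y yE] := @z_ideal_kernel (repr (qproj x : A) - x).
    by apply/twisted_brauer_kernel/qprojP; exact: qrepr.
  apply/eqP; rewrite -subr_eq0; apply/eqP.
  have -> : psi (qproj x) - theta x 0%N = theta (repr (qproj x : A) - x) 0%N.
    by rewrite dualB.
  rewrite yE -(scal_t gentleI m_gt0) [theta _]dualZ.
  by rewrite [LHS]big_ord1 mul0r.
have psiP : psi \in is_form (A := A).
  apply: is_formP => [v v'|c v].
    rewrite -(qrepr v) -(qrepr v') -raddfB !psiE.
    by have /(congr1 (fun s : pseries k => s 0%N)) := dualB theta (repr v) (repr v').
  rewrite -(qrepr v) -[scal c * _](rmorphM qproj) !psiE.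
  rewrite -(scal_ps_const gentleI m_gt0).
  have /(congr1 (fun s : pseries k => s 0%N)) := dualZ theta (ps_const c) (repr v).
  by move=> ->; rewrite [LHS]big_ord1.
apply/symmetric_algebraP; exists (Dual psiP); last first.
  move=> v v'; rewrite -(qrepr v) -(qrepr v') -!rmorphM /= !psiE.
  by have /(congr1 (fun s : pseries k => s 0%N)) := sy (repr v) (repr v').
apply: (@frobenius_of_tracial_multiple _ A _ _ (qproj u) twisted_form_frobenius).
  move=> v v'; rewrite -(qrepr v) -(qrepr v') -!rmorphM /= !psiE.
  by have /(congr1 (fun s : pseries k => s 0%N)) := sy (repr v) (repr v').
move=> v; rewrite -(qrepr v) twisted_formE -qM [RHS]psiE.
have /(congr1 (fun s : pseries k => s 0%N)) <- := uE (repr v).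
by apply: eq_bigr => a _; rewrite mul1n.
Qed.

End TwistedBrauer.

Theorem theorem3p10 (k : fieldType) (Q : quiver) (I : set (pathalg k Q))
    (gentleI : complete_gentle I)
    (m : sorbits I -> nat) (m_gt0 : forall v, (0 < m v)%N)
    (eps : arrow Q -> bool) (polar_eps : polarization eps) :
  let Lambda := ribbon_order gentleI m_gt0 in
  let A := twisted_brauer_algebra m in
  (exists ebar : {rmorphism A -> A},
     [/\ forall x : ribbon_algebra I,
           ebar (qproj x) = qproj (polar_involution gentleI m_gt0 eps x),
         is_alg_morphism ebar,
         involutive ebar &
         bimod_isomorphic (dual_bimod A) (twisted_bimod ebar)]) /\
  (symmetric_algebra Lambda \/
     (exists2 B : algebraOver k, is_brauer_graph_algebra B & alg_isomorphic A B) ->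
   symmetric_algebra A).
Proof.
move=> Lambda A; split.
  have [ebar [eE eA eI eP]] := twisted_involution gentleI m_gt0 polar_eps.
  exists ebar; split=> //.
  apply: (dual_twisted_iso (twisted_form_frobenius gentleI m_gt0 polar_eps)).
  exact: twisted_form_twisted eA eP.
case=> [|[B [_ [Q' [I' [m' [gentleI' m'_gt0 morB]]]]] AB]].
  exact: symmetric_order_reduction polar_eps.
apply: symmetric_algebra_iso AB _; apply: morita_symmetric morB _.
exact: brauer_quotient_symmetric.
Qed.
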